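(* Let $M$ be a transitive model of ZFC such that, in $M$, $\kappa$ is an infinite cardinal and $\vec\mu=\langle\mu_\alpha\colon\alpha<\kappa\rangle$ is a sequence of pairwise distinct normal measures on $\kappa$, and let $S\colon\omega\to\kappa$ (not necessarily in $M$). Then $S$ is a $(\mathbb P_{\vec\mu})^M$-generic sequence over $M$ if and only if for each $\vec\mu$-choice function $F\in M$ there is $0<n<\omega$ such that $S(i)\in F(S(i-1))$ for all $i$ with $n\le i<\omega$.
   Context: A $\vec\mu$-choice function is a function $F$ with domain $\kappa$ such that $F(\alpha)\in\mu_\alpha$ for all $\alpha<\kappa$. Finite sets $s\in[\kappa]^{<\omega}$ are identified with their increasing enumerations. The forcing $\mathbb P_{\vec\mu}$ consists of pairs $(s,F)$ with $s\in[\kappa]^{<\omega}\setminus\{\emptyset\}$ and $F$ a $\vec\mu$-choice function; $(s',F')$ is stronger than $(s,F)$ iff (a) $s\subseteq s'$ and $s'\cap(\max(s)+1)=s$; (b) $F'(\alpha)\subseteq F(\alpha)$ for all $\alpha$; (c) $s'(i)\in F(s'(i-1))$ for $|s|\le i<|s'|$. $(\mathbb P_{\vec\mu})^M$ is this forcing computed in $M$. If $G$ is a $(\mathbb P_{\vec\mu})^M$-generic filter over $M$, its generic sequence is the function $g\colon\omega\to\kappa$ such that for every $0<n<\omega$ there is $F$ with $(\{g(0),\dots,g(n-1)\},F)\in G$; $S$ is a generic sequence over $M$ if it is the generic sequence of some such $G$.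
   Formalization: The formal theorem assumes S strictly increasing; without this the right-to-left direction fails: swapping S(0) and S(1) in a generic sequence keeps the criterion, but no filter contains both ({S(1)},F) and ({S(0),S(1)},F'). *)

(* Defs.v *)
From Stdlib Require Import Init.Wf Arith.

Set Implicit Arguments.
Unset Strict Implicit.

Record set_structure := SetStructure {
  carrier :> Type;
  mem : carrier -> carrier -> Prop
}.

Arguments mem {s} x y.

Notation "x ∈ y" := (mem x y) (at level 70, no associativity).

Definition substructure (V : set_structure) (M : V -> Prop) : set_structure :=
  SetStructure (fun x y : {x : V | M x} => proj1_sig x ∈ proj1_sig y).

Definition val (V : set_structure) (M : V -> Prop) (x : substructure M) : V :=
  proj1_sig x.

Definition extensional (U : set_structure) : Prop :=
  forall x y : U, (forall z, z ∈ x <-> z ∈ y) -> x = y.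

Definition transitive_class (V : set_structure) (M : V -> Prop) : Prop :=
  forall x y : V, M y -> x ∈ y -> M x.

(* de Bruijn variables: variable 0 is bound by the innermost quantifier *)
Inductive formula : Type :=
  | fMem (i j : nat)
  | fEq (i j : nat)
  | fFalse
  | fImp (p q : formula)
  | fAll (p : formula).

Definition scons (A : Type) (x : A) (e : nat -> A) (i : nat) : A :=
  match i with 0 => x | S j => e j end.

Fixpoint sat (U : set_structure) (e : nat -> U) (p : formula) : Prop :=
  match p with
  | fMem i j => e i ∈ e j
  | fEq i j => e i = e j
  | fFalse => False
  | fImp p q => sat e p -> sat e q
  | fAll p => forall x : U, sat (scons x e) p
  end.

(* Set-theoretic notions in a structure [U].
   Operations are rendered by their graphs, so that every quantifier below
   ranges over [U]; at [U := substructure M] each notion is the one computed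
   in [M]. *)

Definition sub (U : set_structure) (x y : U) : Prop :=
  forall z, z ∈ x -> z ∈ y.

Definition is_empty (U : set_structure) (x : U) : Prop :=
  forall z, ~ z ∈ x.

Definition is_upair (U : set_structure) (p a b : U) : Prop :=
  forall z, z ∈ p <-> z = a \/ z = b.

(* p = (a, b) = {{a}, {a, b}} *)
Definition is_opair (U : set_structure) (p a b : U) : Prop :=
  forall z, z ∈ p <-> is_upair z a a \/ is_upair z a b.

(* y = x + 1 = x U {x} *)
Definition is_succ (U : set_structure) (y x : U) : Prop :=
  forall z, z ∈ y <-> z ∈ x \/ z = x.

(* b = {x in a | P x} *)
Definition is_sep (U : set_structure) (b a : U) (P : U -> Prop) : Prop :=
  forall x, x ∈ b <-> x ∈ a /\ P x.

(* f(x) = y *)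
Definition app (U : set_structure) (f x y : U) : Prop :=
  exists p, p ∈ f /\ is_opair p x y.

Definition function_on (U : set_structure) (f a : U) : Prop :=
  (forall p, p ∈ f -> exists x y, x ∈ a /\ is_opair p x y) /\
  (forall x, x ∈ a -> exists! y, app f x y).

Definition bijection (U : set_structure) (f a b : U) : Prop :=
  function_on f a /\
  (forall x y, app f x y -> y ∈ b) /\
  (forall y, y ∈ b -> exists! x, app f x y).

Definition transitive_set (U : set_structure) (x : U) : Prop :=
  forall y, y ∈ x -> sub y x.

Definition ordinal (U : set_structure) (x : U) : Prop :=
  transitive_set x /\ forall y, y ∈ x -> transitive_set y.

Definition natural (U : set_structure) (n : U) : Prop :=
  ordinal n /\
  forall m, m ∈ n \/ m = n -> is_empty m \/ exists k, is_succ m k.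

Definition finite (U : set_structure) (s : U) : Prop :=
  exists n f, natural n /\ bijection f n s.

Definition infinite_cardinal (U : set_structure) (kappa : U) : Prop :=
  ordinal kappa /\
  (forall alpha, alpha ∈ kappa -> ~ exists f, bijection f alpha kappa) /\
  ~ finite kappa.

Record ZFC (U : set_structure) : Prop := {
  zfc_extensionality : extensional U;
  zfc_foundation : forall x : U,
    (exists y, y ∈ x) -> exists y, y ∈ x /\ forall z, z ∈ x -> ~ z ∈ y;
  zfc_pairing : forall a b : U, exists p, is_upair p a b;
  zfc_union : forall a : U, exists u, forall x,
    x ∈ u <-> exists y, y ∈ a /\ x ∈ y;
  zfc_powerset : forall a : U, exists p, forall x, x ∈ p <-> sub x a;
  zfc_infinity : exists w : U,
    (exists z, is_empty z /\ z ∈ w) /\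
    (forall x, x ∈ w -> exists y, is_succ y x /\ y ∈ w);
  zfc_separation : forall (phi : formula) (e : nat -> U) (a : U),
    exists b, is_sep b a (fun x => sat (scons x e) phi);
  zfc_replacement : forall (phi : formula) (e : nat -> U) (a : U),
    (forall x, x ∈ a -> exists! y, sat (scons y (scons x e)) phi) ->
    exists b, forall y,
      y ∈ b <-> exists x, x ∈ a /\ sat (scons y (scons x e)) phi;
  zfc_choice : forall a : U,
    (forall x, x ∈ a -> exists z, z ∈ x) ->
    (forall x y z, x ∈ a -> y ∈ a -> z ∈ x -> z ∈ y -> x = y) ->
    exists c, forall x, x ∈ a -> exists! z, z ∈ x /\ z ∈ c
}.

Definition ultrafilter (U : set_structure) (W kappa : U) : Prop :=
  (forall X, X ∈ W -> sub X kappa) /\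
  kappa ∈ W /\
  (forall X, is_empty X -> ~ X ∈ W) /\
  (forall X Y, X ∈ W -> sub X Y -> sub Y kappa -> Y ∈ W) /\
  (forall X Y Z, X ∈ W -> Y ∈ W -> is_sep Z X (fun b => b ∈ Y) -> Z ∈ W) /\
  (forall X Y, sub X kappa -> is_sep Y kappa (fun b => ~ b ∈ X) ->
     X ∈ W \/ Y ∈ W).

Definition nonprincipal (U : set_structure) (W kappa : U) : Prop :=
  forall alpha X, alpha ∈ kappa -> is_upair X alpha alpha -> ~ X ∈ W.

Definition kappa_complete (U : set_structure) (W kappa : U) : Prop :=
  forall gamma f B, gamma ∈ kappa -> function_on f gamma ->
    (forall i X, app f i X -> X ∈ W) ->
    is_sep B kappa (fun b => forall i X, app f i X -> b ∈ X) ->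
    B ∈ W.

(* closed under diagonal intersections of kappa-sequences of members *)
Definition normal (U : set_structure) (W kappa : U) : Prop :=
  forall f B, function_on f kappa ->
    (forall i X, app f i X -> X ∈ W) ->
    is_sep B kappa (fun b => forall i X, i ∈ b -> app f i X -> b ∈ X) ->
    B ∈ W.

Definition normal_measure (U : set_structure) (W kappa : U) : Prop :=
  ultrafilter W kappa /\ nonprincipal W kappa /\
  kappa_complete W kappa /\ normal W kappa.

Definition distinct_normal_measures (U : set_structure) (kappa mu : U) : Prop :=
  function_on mu kappa /\
  (forall alpha W, app mu alpha W -> normal_measure W kappa) /\
  (forall alpha beta W, app mu alpha W -> app mu beta W -> alpha = beta).

Definition choice_function (U : set_structure) (kappa mu F : U) : Prop :=
  function_on F kappa /\
  forall alpha A W, app F alpha A -> app mu alpha W -> A ∈ W.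

Definition increasing_enumeration (U : set_structure) (e n s : U) : Prop :=
  natural n /\ bijection e n s /\
  forall i j a b, app e i a -> app e j b -> i ∈ j -> a ∈ b.

(* |s| = n, for s a finite set of ordinals *)
Definition has_size (U : set_structure) (s n : U) : Prop :=
  exists e, increasing_enumeration e n s.

(* s(i) = a, for s a finite set of ordinals; in particular i < |s| *)
Definition nth_element (U : set_structure) (s i a : U) : Prop :=
  exists n e, increasing_enumeration e n s /\ app e i a.

Definition is_max (U : set_structure) (m s : U) : Prop :=
  m ∈ s /\ forall x, x ∈ s -> x ∈ m \/ x = m.

Definition condition (U : set_structure) (kappa mu p : U) : Prop :=
  exists s F, is_opair p s F /\
    sub s kappa /\ finite s /\ ~ is_empty s /\ choice_function kappa mu F.

(* p' = (s', F') is stronger than p = (s, F) *)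
Definition stronger (U : set_structure) (p' p : U) : Prop :=
  exists s F s' F', is_opair p s F /\ is_opair p' s' F' /\
    (sub s s' /\
     exists m t, is_max m s /\ is_succ t m /\ is_sep s s' (fun x => x ∈ t)) /\
    (forall alpha A A', app F alpha A -> app F' alpha A' -> sub A' A) /\
    (forall n i j a b,
       has_size s n -> n ∈ i \/ n = i -> is_succ i j ->
       nth_element s' i b -> nth_element s' j a ->
       exists A, app F a A /\ b ∈ A).

Definition is_filter (U : set_structure) (kappa mu : U) (G : U -> Prop) : Prop :=
  (forall p, G p -> condition kappa mu p) /\
  (exists p, G p) /\
  (forall p q, G p -> condition kappa mu q -> stronger p q -> G q) /\
  (forall p q, G p -> G q -> exists r, G r /\ stronger r p /\ stronger r q).

Definition dense (U : set_structure) (kappa mu D : U) : Prop :=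
  (forall p, p ∈ D -> condition kappa mu p) /\
  (forall p, condition kappa mu p -> exists q, q ∈ D /\ stronger q p).

(* [G] need not be an element of [U], whereas the dense sets it has to meet are. *)
Definition generic_filter (U : set_structure) (kappa mu : U) (G : U -> Prop) : Prop :=
  is_filter kappa mu G /\
  forall D, dense kappa mu D -> exists p, G p /\ p ∈ D.

Definition strictly_increasing (V : set_structure) (g : nat -> V) : Prop :=
  forall i j, i < j -> g i ∈ g j.

(* Finite sets being identified with their increasing enumerations,
   {g(0), ..., g(n-1)} stands for the finite set increasingly enumerated by
   g(0), ..., g(n-1). Without monotonicity, the constant sequence with value
   g(0) would also satisfy the second clause. *)
Definition generic_sequence_of (V : set_structure) (M : V -> Prop)
    (G : substructure M -> Prop) (g : nat -> V) : Prop :=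
  strictly_increasing g /\
  forall n, 0 < n -> exists p s F : substructure M,
    G p /\ is_opair p s F /\
    forall x : V, x ∈ val s <-> exists i, i < n /\ x = g i.

Definition generic_sequence (V : set_structure) (M : V -> Prop)
    (kappa mu : substructure M) (g : nat -> V) : Prop :=
  exists G : substructure M -> Prop,
    generic_filter kappa mu G /\ generic_sequence_of G g.

(* Main.v *)
(* If G is generic and F is a choice function, G meets the dense set of the
   conditions (s, H) with H pointwise below F, and from |s| on the generic
   sequence follows H, hence F.

   Conversely, let G be the set of the (S|n, F) such that S follows F from n on;
   only its genericity is hard. Given a dense set D, play the game of extending
   a finite set s by almost all points, in the sense of mu_(max s), until s is
   decided, that is, (s, F) is in D for some F. Ranks are taken below some limit
   ordinal l < kappa; by l-completeness, if s has no rank then neither has almost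
   any one-point extension of s. Were there an s without rank, some choice
   function would therefore keep all extensions of s unranked, contradicting
   density. So every s has a rank, and there is a choice function along which
   ranks decrease and which at alpha is contained in a chosen F_s with (s, F_s)
   in D, for every decided s included in alpha + 1. When S follows it, some S|n
   is decided because membership is well-founded outside of M, and then
   (S|n, F_(S|n)) is in G and in D. *)
From Stdlib Require Import Arith Lia List Classical ClassicalEpsilon Wellfounded.
Require Import Defs.

Set Implicit Arguments.
Unset Strict Implicit.

(** * Definability with parameters *)

Lemma sat_ext (U : set_structure) (p : formula) :
  forall e e' : nat -> U, (forall i, e i = e' i) -> sat e p <-> sat e' p.
Proof.
  induction p as [i j|i j| |p IHp q IHq|p IHp]; simpl; intros e e' E.
  - rewrite !E; tauto.
  - rewrite !E; tauto.
  - tauto.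
  - rewrite (IHp _ _ E), (IHq _ _ E); tauto.
  - assert (E' : forall x i, scons x e i = scons x e' i)
      by (intros x [|i]; simpl; auto).
    split; intros H x; [rewrite <- (IHp _ _ (E' x))|rewrite (IHp _ _ (E' x))];
      apply H.
Qed.

Definition lift_renaming (r : nat -> nat) (i : nat) : nat :=
  match i with 0 => 0 | S j => S (r j) end.

Fixpoint rename (r : nat -> nat) (p : formula) : formula :=
  match p with
  | fMem i j => fMem (r i) (r j)
  | fEq i j => fEq (r i) (r j)
  | fFalse => fFalse
  | fImp p q => fImp (rename r p) (rename r q)
  | fAll p => fAll (rename (lift_renaming r) p)
  end.

Lemma sat_rename (U : set_structure) (p : formula) :
  forall (r : nat -> nat) (e : nat -> U),
    sat e (rename r p) <-> sat (fun i => e (r i)) p.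
Proof.
  induction p as [i j|i j| |p IHp q IHq|p IHp]; simpl; intros r e; try tauto.
  - rewrite IHp, IHq; tauto.
  - assert (E : forall x i, scons x e (lift_renaming r i)
                            = scons x (fun i => e (r i)) i)
      by (intros x [|i]; reflexivity).
    split; intros H x; specialize (H x).
    + rewrite IHp in H. rewrite <- (sat_ext p (E x)). exact H.
    + rewrite IHp. rewrite (sat_ext p (E x)). exact H.
Qed.

(** Serves twice: it interleaves variables (even places) with parameters (odd places), so neither
    supply runs out, and at type [nat] it builds renamings acting separately on the two kinds. *)
Definition merge (A : Type) (e r : nat -> A) (i : nat) : A :=
  if Nat.even i then e (Nat.div2 i) else r (Nat.div2 i).

Lemma merge_even (A : Type) (e r : nat -> A) (i : nat) :
  merge e r (2 * i) = e i.
Proof. unfold merge. now rewrite Nat.even_even, Nat.div2_double. Qed.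

Lemma merge_odd (A : Type) (e r : nat -> A) (i : nat) :
  merge e r (S (2 * i)) = r i.
Proof.
  unfold merge.
  rewrite Nat.div2_succ_double, Nat.even_succ, <- Nat.negb_even, Nat.even_even.
  reflexivity.
Qed.

Lemma sat_rename_merge (U : set_structure) (p : formula) (f h : nat -> nat)
    (E e r : nat -> U) :
  (forall i, E (f i) = e i) -> (forall i, E (h i) = r i) ->
  sat E (rename (merge f h) p) <-> sat (merge e r) p.
Proof.
  intros He Hr. rewrite sat_rename. apply sat_ext.
  intros i. unfold merge. destruct (Nat.even i); auto.
Qed.

(* Parameters from [U] are allowed: they are the odd entries of the assignment.
   The argument of type [U] guarantees that an assignment of parameters exists. *)
Definition definable (U : set_structure) (P : (nat -> U) -> Prop) : Prop :=
  U -> exists phi r, forall e, P e <-> sat (merge e r) phi.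

(** The arguments allowed in an atomic formula: a variable or a parameter. This class is closed
    under the shift of variables below a quantifier. *)
Definition simple_term (U : set_structure) (t : (nat -> U) -> U) : Prop :=
  (exists i, t = fun e => e i) \/ (exists c, t = fun _ => c).

Section Definability.
Variable U : set_structure.
Implicit Types P Q : (nat -> U) -> Prop.
Implicit Types t : (nat -> U) -> U.

Lemma simple_term_var (i : nat) : simple_term (fun e : nat -> U => e i).
Proof. left. now exists i. Qed.

Lemma simple_term_const (c : U) : simple_term (fun _ => c).
Proof. right. now exists c. Qed.

Lemma simple_term_rename t (r : nat -> nat) :
  simple_term t -> simple_term (fun e => t (fun i => e (r i))).
Proof.
  intros [[i ->]|[c ->]].
  - apply simple_term_var.
  - apply simple_term_const.
Qed.

Lemma simple_term_index t :
  simple_term t -> U -> exists i c, forall e, t e = merge e (fun _ => c) i.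
Proof.
  intros [[i ->]|[c ->]] u.
  - exists (2 * i), u. intros e. now rewrite merge_even.
  - exists (S (2 * 0)), c. intros e. now rewrite merge_odd.
Qed.

Lemma definable_ext P Q : (forall e, P e <-> Q e) -> definable P -> definable Q.
Proof.
  intros E H u. destruct (H u) as [phi [r K]].
  exists phi, r. intros e. rewrite <- E. apply K.
Qed.

Lemma definable_imp P Q :
  definable P -> definable Q -> definable (fun e => P e -> Q e).
Proof.
  intros HP HQ u.
  destruct (HP u) as [phi [r H]], (HQ u) as [psi [r' H']].
  (* Both formulas keep their variables; their parameters are interleaved by [merge r r'], those of
     [phi] at its even entries and those of [psi] at its odd ones. *)
  exists (fImp (rename (merge (fun i => 2 * i) (fun i => S (2 * (2 * i)))) phi)
               (rename (merge (fun i => 2 * i) (fun i => S (2 * S (2 * i)))) psi)),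
         (merge r r').
  intros e. cbn [sat].
  rewrite (@sat_rename_merge _ _ _ _ _ e r), (@sat_rename_merge _ _ _ _ _ e r').
  - rewrite H, H'. tauto.
  - intros i. apply merge_even.
  - intros i. now rewrite !merge_odd.
  - intros i. apply merge_even.
  - intros i. now rewrite merge_odd, merge_even.
Qed.

Lemma definable_all (B : (nat -> U) -> U -> Prop) :
  definable (fun e => B (fun i => e (S i)) (e 0)) ->
  definable (fun e => forall x, B e x).
Proof.
  intros HB u. destruct (HB u) as [phi [r H]].
  (* The bound variable takes place 0 and pushes the whole of [merge e r] up by one: the old
     variable j, which is variable j + 1 of [phi], sits at 2j + 1 and parameter i at 2i + 2. *)
  exists (fAll (rename (merge (fun i => match i with 0 => 0 | S j => S (2 * j) end)
                              (fun i => S (S (2 * i)))) phi)), r.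
  intros e. cbn [sat].
  assert (E : forall x, sat (scons x (merge e r)) (rename
      (merge (fun i => match i with 0 => 0 | S j => S (2 * j) end)
             (fun i => S (S (2 * i)))) phi) <-> B e x).
  { intros x. rewrite (@sat_rename_merge _ _ _ _ _ (scons x e) r).
    - symmetry. exact (H (scons x e)).
    - intros [|i]; [reflexivity|exact (merge_even e r i)].
    - intros i. exact (merge_odd e r i). }
  split; intros K x; apply E, K.
Qed.

Lemma definable_false : definable (fun _ : nat -> U => False).
Proof. intros u. exists fFalse, (fun _ => u). reflexivity. Qed.

Lemma definable_atom (f : nat -> nat -> formula) (R : U -> U -> Prop) t t' :
  (forall i j (e : nat -> U), sat e (f i j) <-> R (e i) (e j)) ->
  simple_term t -> simple_term t' -> definable (fun e => R (t e) (t' e)).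
Proof.
  intros Hf Ht Ht' u.
  destruct (simple_term_index Ht u) as [i [c H]].
  destruct (simple_term_index Ht' u) as [j [c' H']].
  exists (f (merge (fun i => 2 * i) (fun i => S (2 * (2 * i))) i)
            (merge (fun i => 2 * i) (fun i => S (2 * S (2 * i))) j)),
         (merge (fun _ => c) (fun _ => c')).
  intros e. rewrite Hf, H, H'.
  assert (E : forall k, merge e (merge (fun _ => c) (fun _ => c'))
      (merge (fun i => 2 * i) (fun i => S (2 * (2 * i))) k)
      = merge e (fun _ => c) k).
  { intros k. unfold merge at 3 4. destruct (Nat.even k).
    - apply merge_even.
    - rewrite merge_odd. apply merge_even. }
  assert (E' : forall k, merge e (merge (fun _ => c) (fun _ => c'))
      (merge (fun i => 2 * i) (fun i => S (2 * S (2 * i))) k)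
      = merge e (fun _ => c') k).
  { intros k. unfold merge at 3 4. destruct (Nat.even k).
    - apply merge_even.
    - rewrite merge_odd. apply merge_odd. }
  now rewrite E, E'.
Qed.

Lemma definable_mem t t' :
  simple_term t -> simple_term t' -> definable (fun e => t e ∈ t' e).
Proof. apply (definable_atom (f := fMem)). reflexivity. Qed.

Lemma definable_eq t t' :
  simple_term t -> simple_term t' -> definable (fun e => t e = t' e).
Proof. apply (definable_atom (f := fEq)). reflexivity. Qed.

Lemma definable_not P : definable P -> definable (fun e => ~ P e).
Proof. intros H. apply definable_imp; [exact H|apply definable_false]. Qed.

Lemma definable_and P Q :
  definable P -> definable Q -> definable (fun e => P e /\ Q e).
Proof.
  intros H K. apply (definable_ext (P := fun e => ~ (P e -> ~ Q e))).
  - intros e. tauto.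
  - apply definable_not, definable_imp; [|apply definable_not]; assumption.
Qed.

Lemma definable_or P Q :
  definable P -> definable Q -> definable (fun e => P e \/ Q e).
Proof.
  intros H K. apply (definable_ext (P := fun e => ~ P e -> Q e)).
  - intros e. tauto.
  - apply definable_imp; [apply definable_not|]; assumption.
Qed.

Lemma definable_exists (B : (nat -> U) -> U -> Prop) :
  definable (fun e => B (fun i => e (S i)) (e 0)) ->
  definable (fun e => exists x, B e x).
Proof.
  intros H. apply (definable_ext (P := fun e => ~ forall x, ~ B e x)).
  - intros e. split; [apply not_all_not_ex|]. intros [x Hx] N. exact (N x Hx).
  - apply definable_not, definable_all, definable_not, H.
Qed.

End Definability.

(** Quantifying over the argument term makes such a hypothesis applicable under any number of
    quantifiers. *)
Definition definable1 (U : set_structure) (P : U -> Prop) : Prop :=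
  forall t : (nat -> U) -> U, simple_term t -> definable (fun e => P (t e)).

Definition definable2 (U : set_structure) (R : U -> U -> Prop) : Prop :=
  forall t t' : (nat -> U) -> U, simple_term t -> simple_term t' ->
    definable (fun e => R (t e) (t' e)).

Ltac solve_simple_term :=
  first [ apply simple_term_var | apply simple_term_const | assumption
        | match goal with
          | H : simple_term _ |- simple_term _ => apply (simple_term_rename _ H)
          end ].

(** Syntax-directed search; named set-theoretic notions are unfolded only as a last resort. *)
Ltac definability_step :=
  cbv beta;
  first
  [ match goal with
    | H : definable1 _ |- _ => apply H; solve_simple_term
    | H : definable2 _ |- _ => apply H; solve_simple_term
    end
  | apply definable_mem; solve_simple_term
  | apply definable_eq; solve_simple_term
  | apply definable_false
  | apply definable_and
  | apply definable_or
  | apply definable_not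
  | apply definable_exists
  | apply definable_imp
  | apply definable_all
  | progress unfold iff, unique, sub, is_empty, is_upair, is_opair, is_succ,
      is_sep, app, function_on, bijection, transitive_set, ordinal, natural,
      finite, is_max, choice_function, condition ].

Ltac definability :=
  try (match goal with |- definable1 _ => intros ? ? | |- definable2 _ => intros ? ? ? ? end);
  repeat definability_step.

(** * Sets, ordinals and finite sets inside a well-founded model *)

Section SetTheory.
Variable U : set_structure.
Hypothesis HZ : ZFC U.
Hypothesis Hwf : well_founded (@mem U).
Implicit Types a b c x y z p s t u : U.

Lemma separation (P : U -> Prop) (a : U) :
  definable1 P -> exists b, is_sep b a P.
Proof.
  intros HP. destruct (HP _ (simple_term_var U 0) a) as [phi [r H]].
  (* Every variable of [phi] is read as the element under test, at place 0, and parameter i moves to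
     place i + 1. *)
  destruct (zfc_separation HZ (rename (merge (fun _ => 0) S) phi) r a) as [b Hb].
  exists b. intros x. rewrite (Hb x), (@sat_rename_merge _ _ _ _ _ (fun _ => x) r).
  - rewrite <- H. reflexivity.
  - reflexivity.
  - reflexivity.
Qed.

Lemma replacement (R : U -> U -> Prop) (a : U) :
  definable2 R -> (forall x, x ∈ a -> exists! y, R x y) ->
  exists b, forall y, y ∈ b <-> exists x, x ∈ a /\ R x y.
Proof.
  intros HR Hf.
  destruct (HR _ _ (simple_term_var U 1) (simple_term_var U 0) a) as [phi [r H]].
  (* Variable 0 is the value y and all others are the argument x; the parameters start at place
     2. *)
  pose (f := merge (fun i => match i with 0 => 0 | S _ => 1 end)
                   (fun i => S (S i))).
  assert (E : forall x y, R x y <-> sat (scons y (scons x r)) (rename f phi)).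
  { intros x y. unfold f.
    rewrite (@sat_rename_merge _ _ _ _ _ (fun i => match i with 0 => y | S _ => x end) r).
    - rewrite <- H. reflexivity.
    - intros [|i]; reflexivity.
    - reflexivity. }
  destruct (zfc_replacement HZ (phi := rename f phi) (e := r) (a := a)) as [b Hb].
  - intros x Hx. destruct (Hf x Hx) as [y [Hy Hu]]. exists y. split.
    + apply E, Hy.
    + intros y' Hy'. apply Hu, E, Hy'.
  - exists b. intros y. rewrite Hb.
    split; intros [x [Hx K]]; exists x; (split; [exact Hx|apply E, K]).
Qed.

Lemma mem_irrefl x : ~ x ∈ x.
Proof.
  induction (Hwf x) as [x _ IH]. intros H. exact (IH x H H).
Qed.

Lemma mem_asym x : forall y, x ∈ y -> ~ y ∈ x.
Proof.
  induction (Hwf x) as [x _ IH]. intros y H K. exact (IH y K x K H).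
Qed.

Lemma empty_exists : exists x : U, is_empty x.
Proof. destruct (zfc_infinity HZ) as [w [[z [H _]] _]]. now exists z. Qed.

Definition empty : U := proj1_sig (constructive_indefinite_description _ empty_exists).

Lemma not_mem_empty x : ~ x ∈ empty.
Proof.
  unfold empty. destruct constructive_indefinite_description as [y H]. apply H.
Qed.

Lemma is_empty_empty : is_empty empty.
Proof. exact not_mem_empty. Qed.

Lemma union_exists a b : exists c, forall x, x ∈ c <-> x ∈ a \/ x ∈ b.
Proof.
  destruct (zfc_pairing HZ a b) as [p Hp]. destruct (zfc_union HZ p) as [c Hc].
  exists c. intros x. rewrite Hc. split.
  - intros [y [Hy Hx]]. apply Hp in Hy. destruct Hy as [->| ->]; tauto.
  - intros [H|H]; [exists a|exists b]; (split; [apply Hp; tauto|exact H]).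
Qed.

(** Relational twin of [adj]. As [adj a b] is not a simple term, predicates that have to be
    definable speak of [is_adj] instead. *)
Definition is_adj (c a b : U) : Prop := forall z, z ∈ c <-> z ∈ a \/ z = b.

Lemma adj_exists a b : exists c, is_adj c a b.
Proof.
  destruct (zfc_pairing HZ b b) as [p Hp]. destruct (union_exists a p) as [c Hc].
  exists c. intros x. rewrite Hc. specialize (Hp x). tauto.
Qed.

Definition adj a b : U :=
  proj1_sig (constructive_indefinite_description _ (adj_exists a b)).

Lemma mem_adj a b x : x ∈ adj a b <-> x ∈ a \/ x = b.
Proof.
  unfold adj. destruct constructive_indefinite_description as [y H]. apply H.
Qed.

Lemma set_ext (x y : U) : (forall z, z ∈ x <-> z ∈ y) -> x = y.
Proof. apply (zfc_extensionality HZ). Qed.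

Lemma is_adjE c a b : is_adj c a b <-> c = adj a b.
Proof.
  split.
  - intros H. apply set_ext. intros z. rewrite mem_adj. apply H.
  - intros ->. intros z. apply mem_adj.
Qed.

Lemma is_upairE p a b : is_upair p a b <-> p = adj (adj empty a) b.
Proof.
  assert (E : forall z, z ∈ adj (adj empty a) b <-> z = a \/ z = b).
  { intros z. rewrite !mem_adj. pose proof (not_mem_empty (x := z)). tauto. }
  split.
  - intros H. apply set_ext. intros z. rewrite E. apply H.
  - intros ->. exact E.
Qed.

Lemma mem_upair a b z : z ∈ adj (adj empty a) b <-> z = a \/ z = b.
Proof. revert z. now apply is_upairE. Qed.

Definition pair a b : U := adj (adj empty (adj (adj empty a) a)) (adj (adj empty a) b).

Lemma is_opairE p a b : is_opair p a b <-> p = pair a b.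
Proof.
  unfold pair. rewrite <- is_upairE. unfold is_opair.
  split; intros H z; rewrite (H z), !is_upairE; reflexivity.
Qed.

Lemma upair_inj a b c d :
  adj (adj empty a) b = adj (adj empty c) d -> (a = c /\ b = d) \/ (a = d /\ b = c).
Proof.
  intros E.
  pose proof (mem_upair a b) as H. pose proof (mem_upair c d) as K.
  rewrite <- E in K.
  assert (H' : forall z, z = a \/ z = b <-> z = c \/ z = d)
    by (intros z; rewrite <- H; apply K).
  destruct (proj1 (H' a) (or_introl eq_refl)) as [<-|<-];
  destruct (proj1 (H' b) (or_intror eq_refl)) as [<-|<-]; auto.
  - destruct (proj2 (H' d) (or_intror eq_refl)); auto.
  - destruct (proj2 (H' c) (or_introl eq_refl)); auto.
Qed.

Lemma pair_inj a b c d : pair a b = pair c d -> a = c /\ b = d.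
Proof.
  intros E. apply upair_inj in E.
  destruct E as [[E1 E2]|[E1 E2]];
    apply upair_inj in E1; apply upair_inj in E2; intuition congruence.
Qed.

Lemma appE f x y : app f x y <-> pair x y ∈ f.
Proof.
  split.
  - intros [p [Hp K]]. apply is_opairE in K. now subst.
  - intros H. exists (pair x y). split; [exact H|now apply is_opairE].
Qed.

(** Such pairs are sets of subsets of the union of a and b, so the double power set contains them.
    An upper bound suffices, since separation cuts it down. *)
Lemma product_bound a b : exists c, forall x y, x ∈ a -> y ∈ b -> pair x y ∈ c.
Proof.
  destruct (union_exists a b) as [u Hu].
  destruct (zfc_powerset HZ u) as [q Hq]. destruct (zfc_powerset HZ q) as [c Hc].
  exists c. intros x y Hx Hy. apply Hc. intros z Hz. apply Hq. intros w Hw.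
  apply mem_upair in Hz. apply Hu.
  destruct Hz as [->| ->]; apply mem_upair in Hw; destruct Hw as [->| ->]; tauto.
Qed.

(* The graph of [i |-> {b in k | P i b}]. *)
Lemma sections_function (P : U -> U -> Prop) (d k : U) :
  definable2 P ->
  exists f, function_on f d /\
    forall i X, app f i X <-> i ∈ d /\ is_sep X k (P i).
Proof.
  intros HP.
  destruct (replacement (R := fun i p => exists X, is_opair p i X /\ is_sep X k (P i))
              (a := d)) as [f Hf].
  - definability.
  - intros i Hi. destruct (separation (P := P i) k) as [X HX]; [definability|].
    exists (pair i X). split.
    + exists X. split; [now apply is_opairE|exact HX].
    + intros p [Y [Hp HY]]. apply is_opairE in Hp. subst p. f_equal.
      apply set_ext. intros z. rewrite (HX z), (HY z). reflexivity.
  - assert (E : forall i X, app f i X <-> i ∈ d /\ is_sep X k (P i)).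
    { intros i X. rewrite appE, Hf. split.
      - intros [j [Hj [Y [E HY]]]]. apply is_opairE, pair_inj in E.
        destruct E as [-> ->]. auto.
      - intros [Hi HX]. exists i. split; [exact Hi|]. exists X.
        split; [now apply is_opairE|exact HX]. }
    exists f. split; [split|exact E].
    + intros p Hp. apply Hf in Hp. destruct Hp as [i [Hi [X [Hp _]]]].
      exists i, X. auto.
    + intros i Hi. destruct (separation (P := P i) k) as [X HX]; [definability|].
      exists X. split; [now apply E|].
      intros Y HY. apply E in HY. destruct HY as [_ HY].
      apply set_ext. intros z. rewrite (HX z), (HY z). reflexivity.
Qed.

Lemma function_app f a x : function_on f a -> x ∈ a -> exists y, app f x y.
Proof. intros [_ H] Hx. destruct (H x Hx) as [y [Hy _]]. now exists y. Qed.

Lemma function_app_dom f a x y : function_on f a -> app f x y -> x ∈ a.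
Proof.
  intros [H _] [p [Hp K]]. destruct (H p Hp) as [x' [y' [Hx K']]].
  apply is_opairE in K, K'. subst p. apply pair_inj in K'.
  destruct K' as [-> _]. exact Hx.
Qed.

Lemma function_app_unique f a x y y' :
  function_on f a -> app f x y -> app f x y' -> y = y'.
Proof.
  intros H K K'. destruct (proj2 H x (function_app_dom H K)) as [z [_ Hz]].
  rewrite <- (Hz y K). exact (Hz y' K').
Qed.

Lemma ordinal_mem a x : ordinal a -> x ∈ a -> ordinal x.
Proof.
  intros [T H] Hx. split; [now apply H|].
  intros y Hy. apply H. exact (T x Hx y Hy).
Qed.

Lemma ordinal_trans a x y : ordinal a -> x ∈ a -> y ∈ x -> y ∈ a.
Proof. intros [T _] Hx Hy. exact (T x Hx y Hy). Qed.

(** Double induction: if a and b are incomparable, the induction hypotheses put every element of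
    either into the other, so a = b. *)
Lemma ordinal_trichotomy a : forall b, ordinal a -> ordinal b ->
  a ∈ b \/ a = b \/ b ∈ a.
Proof.
  induction (Hwf a) as [a _ IHa]. intros b.
  induction (Hwf b) as [b _ IHb]. intros Ha Hb.
  apply NNPP. intros N. apply N. right. left. apply set_ext. intros z. split.
  - intros Hz. destruct (IHa z Hz b (ordinal_mem Ha Hz) Hb) as [H|[H|H]].
    + exact H.
    + subst z. tauto.
    + exfalso. apply N. right. right. exact (ordinal_trans Ha Hz H).
  - intros Hz. destruct (IHb z Hz Ha (ordinal_mem Hb Hz)) as [H|[H|H]].
    + exfalso. apply N. left. exact (ordinal_trans Hb Hz H).
    + subst z. tauto.
    + exact H.
Qed.

(** * Natural numbers and finite sets of ordinals, indexed from outside by [nat] *)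

Fixpoint num (n : nat) : U :=
  match n with 0 => empty | S k => adj (num k) (num k) end.

Lemma mem_num n x : x ∈ num n <-> exists i, i < n /\ x = num i.
Proof.
  revert x. induction n as [|n IH]; intros x; simpl.
  - split; [intros H; destruct (not_mem_empty H)|intros [i [H _]]; lia].
  - rewrite mem_adj, IH. split.
    + intros [[i [Hi ->]]| ->]; [exists i|exists n]; auto.
    + intros [i [Hi ->]]. destruct (Nat.eq_dec i n) as [->|N]; [auto|].
      left. exists i. split; [lia|reflexivity].
Qed.

Lemma num_lt i j : i < j -> num i ∈ num j.
Proof. intros H. apply mem_num. exists i. auto. Qed.

Lemma num_inj i j : num i = num j -> i = j.
Proof.
  intros E. destruct (Nat.lt_total i j) as [H|[H|H]]; [|exact H|];
    apply num_lt in H; rewrite E in H; destruct (mem_irrefl H).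
Qed.

Lemma num_mem_lt i j : num i ∈ num j -> i < j.
Proof.
  intros H. apply mem_num in H. destruct H as [k [Hk E]].
  apply num_inj in E. lia.
Qed.

Lemma num_succ k : is_succ (num (S k)) (num k).
Proof. intros z. apply mem_adj. Qed.

Lemma is_succ_num t k : is_succ t (num k) <-> t = num (S k).
Proof. exact (is_adjE t (num k) (num k)). Qed.

Lemma natural_num k : natural (num k).
Proof.
  assert (T : forall n, transitive_set (num n)).
  { intros n y Hy z Hz. apply mem_num in Hy. destruct Hy as [i [Hi ->]].
    apply mem_num in Hz. destruct Hz as [j [Hj ->]]. apply num_lt. lia. }
  split; [split; [apply T|]|].
  - intros y Hy. apply mem_num in Hy. destruct Hy as [i [_ ->]]. apply T.
  - intros m Hm.
    assert (E : exists i, m = num i).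
    { destruct Hm as [Hm| ->]; [|now exists k].
      apply mem_num in Hm. destruct Hm as [i [_ ->]]. now exists i. }
    destruct E as [[|i] ->]; [left; exact is_empty_empty|].
    right. exists (num i). apply num_succ.
Qed.

(** Well-foundedness makes the natural numbers of the model standard; hence what the model considers
    finite is finite from outside. *)
Lemma natural_is_num n : natural n -> exists k, n = num k.
Proof.
  induction (Hwf n) as [n _ IH]. intros [On Hn].
  destruct (Hn n (or_intror eq_refl)) as [H|[m Hm]].
  - exists 0. apply set_ext. intros z.
    pose proof (H z). pose proof (not_mem_empty (x := z)). simpl; tauto.
  - assert (Mn : m ∈ n) by (apply Hm; auto).
    destruct (IH m Mn) as [k ->].
    + split; [exact (ordinal_mem On Mn)|]. intros z Hz. apply Hn.
      left. apply Hm. destruct Hz as [Hz| ->]; auto.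
    + exists (S k). now apply is_succ_num.
Qed.

(** The function g lives outside the model and need not be a set of it; thus one g describes all
    initial segments of a sequence. *)
Fixpoint fset (n : nat) (g : nat -> U) : U :=
  match n with 0 => empty | S k => adj (fset k g) (g k) end.

Lemma mem_fset n g x : x ∈ fset n g <-> exists i, i < n /\ x = g i.
Proof.
  induction n as [|n IH]; simpl.
  - split; [intros H; destruct (not_mem_empty H)|intros [i [H _]]; lia].
  - rewrite mem_adj, IH. split.
    + intros [[i [Hi ->]]| ->]; [exists i|exists n]; auto.
    + intros [i [Hi ->]]. destruct (Nat.eq_dec i n) as [->|N]; [auto|].
      left. exists i. split; [lia|reflexivity].
Qed.

Lemma fset_eq n g g' : (forall i, i < n -> g i = g' i) -> fset n g = fset n g'.
Proof.
  induction n as [|n IH]; intros E; simpl; [reflexivity|].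
  rewrite IH, E; auto.
Qed.

Definition incr (n : nat) (g : nat -> U) : Prop :=
  forall i j, i < j -> j < n -> g i ∈ g j.

Lemma incr_lt n g i j : incr n g -> i < n -> j < n -> g i ∈ g j -> i < j.
Proof.
  intros H Hi Hj K. destruct (Nat.lt_total i j) as [L|[->|L]].
  - exact L.
  - destruct (mem_irrefl K).
  - destruct (mem_asym K). now apply H.
Qed.

Lemma incr_inj n g i j : incr n g -> i < n -> j < n -> g i = g j -> i = j.
Proof.
  intros H Hi Hj E. destruct (Nat.lt_total i j) as [L|[L|L]]; [|exact L|].
  - pose proof (H _ _ L Hj) as K. rewrite E in K. destruct (mem_irrefl K).
  - pose proof (H _ _ L Hi) as K. rewrite E in K. destruct (mem_irrefl K).
Qed.

Lemma incr_le n m g : n <= m -> incr m g -> incr n g.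
Proof. intros L H i j Hij Hj. apply H; lia. Qed.

(** By induction on i, the element g i is g' j for some j >= i, and g' i is g k for some k >= i. If
    both inequalities were strict, g i and g' i would be elements of each other. *)
Lemma enumeration_unique n g n' g' :
  incr n g -> incr n' g' -> fset n g = fset n' g' ->
  n = n' /\ forall i, i < n -> g i = g' i.
Proof.
  assert (K : forall n g n' g', incr n g -> incr n' g' -> fset n g = fset n' g' ->
    forall i, i < n -> i < n' /\ g i = g' i).
  { clear n g n' g'. intros n g n' g' H H' E i.
    induction i as [i IH] using lt_wf_ind. intros Hi.
    assert (A : g i ∈ fset n' g') by (rewrite <- E; apply mem_fset; eauto).
    apply mem_fset in A. destruct A as [j [Hj Ej]].
    assert (Lij : i <= j).
    { apply Nat.nlt_ge. intros L. destruct (IH j L) as [_ Ej']; [lia|].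
      apply (mem_irrefl (x := g i)). rewrite Ej at 1. rewrite <- Ej'.
      now apply H. }
    split; [lia|].
    assert (B : g' i ∈ fset n g) by (rewrite E; apply mem_fset; exists i; split; [lia|reflexivity]).
    apply mem_fset in B. destruct B as [k [Hk Ek]].
    assert (Lik : i <= k).
    { apply Nat.nlt_ge. intros L. destruct (IH k L) as [_ Ek']; [lia|].
      apply (mem_irrefl (x := g' i)). rewrite Ek at 1. rewrite Ek'.
      apply H'; lia. }
    destruct (Nat.eq_dec i j) as [->|Nij]; [exact Ej|].
    assert (C : g' i ∈ g i) by (rewrite Ej; apply H'; lia).
    destruct (Nat.eq_dec i k) as [->|Nik]; [now symmetry|].
    assert (D : g i ∈ g' i) by (rewrite Ek; apply H; lia).
    destruct (mem_asym C D). }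
  intros H H' E. split.
  - pose proof (K _ _ _ _ H H' E) as A.
    pose proof (K _ _ _ _ H' H (eq_sym E)) as B.
    destruct (Nat.lt_total n n') as [L|[L|L]]; [|exact L|].
    + destruct (B n L); lia.
    + destruct (A n' L); lia.
  - intros i Hi. now apply (K _ _ _ _ H H' E).
Qed.

Lemma enumeration_exists n g : incr n g ->
  exists e, increasing_enumeration e (num n) (fset n g) /\
    forall i, i < n -> app e (num i) (g i).
Proof.
  intros H.
  pose (e := fset n (fun k => pair (num k) (g k))).
  assert (E : forall x y, app e x y <-> exists k, k < n /\ x = num k /\ y = g k).
  { intros x y. rewrite appE. unfold e. rewrite mem_fset.
    split; intros [k [Hk A]]; exists k; (split; [exact Hk|]).
    - now apply pair_inj.
    - now destruct A as [-> ->]. }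
  exists e. split; [split; [apply natural_num|split; [split; [split|split]|]]|].
  - intros p Hp. apply mem_fset in Hp. destruct Hp as [k [Hk ->]].
    exists (num k), (g k). split; [now apply num_lt|now apply is_opairE].
  - intros x Hx. apply mem_num in Hx. destruct Hx as [k [Hk ->]].
    exists (g k). split; [apply E; eauto|].
    intros y Hy. apply E in Hy. destruct Hy as [j [_ [Ej ->]]].
    now apply num_inj in Ej; subst.
  - intros x y Hy. apply E in Hy. destruct Hy as [j [Hj [_ ->]]].
    apply mem_fset. eauto.
  - intros y Hy. apply mem_fset in Hy. destruct Hy as [k [Hk ->]].
    exists (num k). split; [apply E; eauto|].
    intros x Hx. apply E in Hx. destruct Hx as [j [Hj [-> Ej]]].
    f_equal. exact (incr_inj H Hk Hj Ej).
  - intros i j a b Hi Hj Hij. apply E in Hi, Hj.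
    destruct Hi as [k [Hk [-> ->]]], Hj as [l [Hl [-> ->]]].
    apply H; [exact (num_mem_lt Hij)|exact Hl].
  - intros i Hi. apply E. eauto.
Qed.

Lemma bijection_num f n s : bijection f (num n) s ->
  exists g, s = fset n g /\ forall x y, app f x y <-> exists k, k < n /\ x = num k /\ y = g k.
Proof.
  intros [Ff [Hi Hs]].
  (* Values of g from n on are arbitrary and never looked at. *)
  pose (g := fun k => epsilon (inhabits empty) (fun y => app f (num k) y)).
  assert (G : forall k, k < n -> app f (num k) (g k)).
  { intros k Hk. unfold g. apply epsilon_spec.
    apply (function_app Ff). now apply num_lt. }
  assert (E : forall x y, app f x y <-> exists k, k < n /\ x = num k /\ y = g k).
  { intros x y. split.
    - intros Hxy. pose proof (function_app_dom Ff Hxy) as Hx.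
      apply mem_num in Hx. destruct Hx as [k [Hk ->]]. exists k.
      repeat split; auto. apply (function_app_unique Ff Hxy). auto.
    - intros [k [Hk [-> ->]]]. auto. }
  exists g. split; [|exact E]. apply set_ext. intros y. rewrite mem_fset. split.
  - intros Hy. destruct (Hs y Hy) as [x [Hx _]]. apply E in Hx.
    destruct Hx as [k [Hk [_ ->]]]. eauto.
  - intros [k [Hk ->]]. apply (Hi (num k)). auto.
Qed.

Lemma increasing_enumerationE e n s : increasing_enumeration e n s ->
  exists N g, n = num N /\ s = fset N g /\ incr N g /\
    forall x y, app e x y <-> exists k, k < N /\ x = num k /\ y = g k.
Proof.
  intros [Hn [Hb Hm]]. destruct (natural_is_num Hn) as [N ->].
  destruct (bijection_num Hb) as [g [-> E]].
  exists N, g. repeat split; [|apply E..].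
  intros i j Hij Hj. apply (Hm (num i) (num j)).
  - apply E. exists i. repeat split; lia.
  - apply E. exists j. auto.
  - now apply num_lt.
Qed.

Lemma has_size_fset n g x : incr n g -> has_size (fset n g) x <-> x = num n.
Proof.
  intros H. split.
  - intros [e He]. destruct (increasing_enumerationE He) as [N [g' [-> [E [H' _]]]]].
    now destruct (enumeration_unique H H' E) as [-> _].
  - intros ->. destruct (enumeration_exists H) as [e [He _]]. now exists e.
Qed.

Lemma nth_element_fset n g x a : incr n g ->
  nth_element (fset n g) x a <-> exists k, k < n /\ x = num k /\ a = g k.
Proof.
  intros H. split.
  - intros [m [e [He Hx]]].
    destruct (increasing_enumerationE He) as [N [g' [-> [E [H' A]]]]].
    destruct (enumeration_unique H H' E) as [-> G].
    apply A in Hx. destruct Hx as [k [Hk [-> ->]]]. exists k.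
    repeat split; auto. symmetry. auto.
  - intros [k [Hk [-> ->]]]. destruct (enumeration_exists H) as [e [He A]].
    exists (num n), e. auto.
Qed.

Lemma finite_fset n g : incr n g -> finite (fset n g).
Proof.
  intros H. destruct (enumeration_exists H) as [e [[Hn [Hb _]] _]].
  exists (num n), e. auto.
Qed.

(** Finiteness is handled as inclusion in a list of the metatheory: this gives an induction on the
    list, and it passes at once to subsets and to sets with one more point. *)
Lemma listed_max (l : list U) : forall s,
  (forall x, x ∈ s -> List.In x l) -> (forall x, x ∈ s -> ordinal x) ->
  s <> empty -> exists m, is_max m s.
Proof.
  induction l as [|a l IH]; intros s Hl Ho Hs.
  - destruct Hs. apply set_ext. intros z. split; intros Hz.
    + destruct (Hl z Hz).
    + destruct (not_mem_empty Hz).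
  - destruct (separation (P := fun x => x <> a) s) as [s' Hs']; [definability|].
    destruct (classic (s' = empty)) as [E|N].
    + assert (A : forall x, x ∈ s -> x = a).
      { intros x Hx. apply NNPP. intros N. apply (not_mem_empty (x := x)).
        rewrite <- E. now apply Hs'. }
      exists a. split; [|auto]. apply NNPP. intros N. apply Hs.
      apply set_ext. intros z. split; intros Hz.
      * pose proof (A z Hz). now subst.
      * destruct (not_mem_empty Hz).
    + destruct (IH s') as [m [Hm M]]; [| |exact N|].
      * intros x Hx. apply Hs' in Hx. destruct Hx as [Hx Nx].
        destruct (Hl x Hx) as [<-|K]; [now destruct Nx|exact K].
      * intros x Hx. now apply Ho, Hs'.
      * assert (Sm : m ∈ s) by now apply Hs'.
        assert (M' : forall x, x ∈ s -> x <> a -> x ∈ m \/ x = m)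
          by (intros x Hx Nx; apply M; now apply Hs').
        destruct (classic (a ∈ s)) as [Ha|Na].
        -- destruct (ordinal_trichotomy (Ho a Ha) (Ho m Sm)) as [L|[<-|L]].
           ++ exists m. split; [exact Sm|]. intros x Hx.
              destruct (classic (x = a)) as [->|]; auto.
           ++ exists a. split; [exact Ha|]. intros x Hx.
              destruct (classic (x = a)) as [->|]; auto.
           ++ exists a. split; [exact Ha|]. intros x Hx.
              destruct (classic (x = a)) as [->|Nx]; [auto|left].
              destruct (M' x Hx Nx) as [K| ->]; [|exact L].
              exact (ordinal_trans (Ho a Ha) L K).
        -- exists m. split; [exact Sm|]. intros x Hx.
           apply M'; congruence.
Qed.

(** Induction on the bound d: the largest element m of s is enumerated last, and the rest of s is
    bounded by m, which is smaller than d. *)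
Lemma listed_enumeration (l : list U) d : ordinal d -> forall s, sub s d ->
  (forall x, x ∈ s -> List.In x l) -> exists n g, incr n g /\ s = fset n g.
Proof.
  induction (Hwf d) as [d _ IH]. intros Hd s Hs Hl.
  destruct (classic (s = empty)) as [->|N].
  - exists 0, (fun _ => empty). split; [intros i j _ Hj; lia|reflexivity].
  - destruct (listed_max Hl) as [m [Hm M]]; [|exact N|].
    + intros x Hx. exact (ordinal_mem Hd (Hs x Hx)).
    + destruct (separation (P := fun x => x ∈ m) s) as [s' Hs']; [definability|].
      pose proof (Hs m Hm) as Dm.
      destruct (IH m Dm (ordinal_mem Hd Dm) s') as [n [g [Hg E]]].
      * intros x Hx. now apply Hs'.
      * intros x Hx. now apply Hl, Hs'.
      * pose (g' := fun i => if i =? n then m else g i).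
        assert (En : g' n = m) by (unfold g'; now rewrite Nat.eqb_refl).
        assert (Eg : forall i, i < n -> g' i = g i).
        { intros i Hi. unfold g'. destruct (Nat.eqb_spec i n); [lia|reflexivity]. }
        exists (S n), g'. split.
        -- intros i j Hij Hj. rewrite (Eg i) by lia.
           destruct (Nat.eq_dec j n) as [->|Nj].
           ++ rewrite En. apply Hs'. rewrite E. apply mem_fset. eauto.
           ++ rewrite (Eg j) by lia. apply Hg; lia.
        -- simpl. rewrite En, (fset_eq Eg), <- E. apply set_ext. intros z.
           rewrite mem_adj, (Hs' z). split.
           ++ intros Hz. destruct (M z Hz); auto.
           ++ intros [[Hz _]| ->]; auto.
Qed.

Lemma fset_listed n g : exists l, forall x, x ∈ fset n g -> List.In x l.
Proof.
  exists (List.map g (List.seq 0 n)). intros x Hx. apply mem_fset in Hx.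
  destruct Hx as [i [Hi ->]]. apply List.in_map, List.in_seq. lia.
Qed.

Lemma finite_listed s : finite s -> exists l, forall x, x ∈ s -> List.In x l.
Proof.
  intros [n [f [Hn Hf]]]. destruct (natural_is_num Hn) as [k ->].
  destruct (bijection_num Hf) as [g [-> _]]. apply fset_listed.
Qed.

Lemma listed_finite (l : list U) d s : ordinal d -> sub s d ->
  (forall x, x ∈ s -> List.In x l) -> finite s.
Proof.
  intros Hd Hs Hl. destruct (listed_enumeration Hd Hs Hl) as [n [g [Hg ->]]].
  now apply finite_fset.
Qed.

Lemma finite_enumeration d s : ordinal d -> sub s d -> finite s ->
  exists n g, incr n g /\ s = fset n g.
Proof.
  intros Hd Hs Hf. destruct (finite_listed Hf) as [l Hl].
  exact (listed_enumeration Hd Hs Hl).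
Qed.

Lemma finite_max d s : ordinal d -> sub s d -> finite s -> s <> empty ->
  exists m, is_max m s.
Proof.
  intros Hd Hs Hf. destruct (finite_listed Hf) as [l Hl]. apply (listed_max Hl).
  intros x Hx. exact (ordinal_mem Hd (Hs x Hx)).
Qed.

Lemma finite_sub d s s' : ordinal d -> sub s d -> finite s -> sub s' s -> finite s'.
Proof.
  intros Hd Hs Hf H. destruct (finite_listed Hf) as [l Hl].
  apply (listed_finite (l := l) Hd); unfold sub in *; auto.
Qed.

Lemma finite_adj d s b : ordinal d -> sub s d -> b ∈ d -> finite s -> finite (adj s b).
Proof.
  intros Hd Hs Hb Hf. destruct (finite_listed Hf) as [l Hl].
  apply (listed_finite (l := b :: l) Hd); intros x Hx; apply mem_adj in Hx;
    destruct Hx as [Hx| ->]; simpl; auto.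
Qed.

Lemma finite_empty : finite empty.
Proof.
  apply (finite_fset (n := 0) (g := fun _ => empty)). intros i j _ Hj. lia.
Qed.

(** * Normal measures *)

(** Measure one for arbitrary predicates, definable or not, which makes monotonicity unconditional.
    [large_sep] returns to sets of the model. *)
Definition large (W : U) (P : U -> Prop) : Prop :=
  exists X, X ∈ W /\ forall b, b ∈ X -> P b.

Lemma large_mono W (P Q : U -> Prop) :
  (forall b, P b -> Q b) -> large W P -> large W Q.
Proof. intros H [X [HX K]]. exists X. auto. Qed.

Section Measure.
Variables k W : U.
Hypothesis Hk : ordinal k.
Hypothesis HW : normal_measure W k.
Implicit Types P Q : U -> Prop.

Lemma measure_sub X : X ∈ W -> sub X k.
Proof. destruct HW as [[H _] _]. apply H. Qed.

Lemma large_all P : (forall b, b ∈ k -> P b) -> large W P.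
Proof. intros H. exists k. split; [apply HW|exact H]. Qed.

Lemma large_dom P : large W P -> large W (fun b => b ∈ k /\ P b).
Proof.
  intros [X [HX K]]. exists X. split; [exact HX|].
  intros b Hb. split; [exact (measure_sub HX Hb)|auto].
Qed.

Lemma large_and P Q : large W P -> large W Q -> large W (fun b => P b /\ Q b).
Proof.
  intros [X [HX K]] [Y [HY L]].
  destruct (separation (P := fun b => b ∈ Y) X) as [Z HZ']; [definability|].
  exists Z. split.
  - destruct HW as [[_ [_ [_ [_ [H _]]]]] _]. exact (H X Y Z HX HY HZ').
  - intros b Hb. apply HZ' in Hb. destruct Hb; auto.
Qed.

Lemma large_nonempty P : large W P -> exists b, b ∈ k /\ P b.
Proof.
  intros H. apply large_dom in H. destruct H as [X [HX K]].
  apply NNPP. intros N. destruct HW as [[_ [_ [H _]]] _].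
  apply (H X); [|exact HX]. intros z Hz. apply N. exists z. auto.
Qed.

Lemma large_sep P X : large W P -> is_sep X k P -> X ∈ W.
Proof.
  intros [Y [HY K]] HX. destruct HW as [[_ [_ [_ [H _]]]] _].
  apply (H Y X HY).
  - intros b Hb. apply HX. split; [exact (measure_sub HY Hb)|auto].
  - intros b Hb. now apply HX.
Qed.

Lemma large_or_not P : definable1 P -> large W P \/ large W (fun b => ~ P b).
Proof.
  intros HP. destruct (separation k HP) as [X HX].
  destruct (separation (P := fun b => ~ b ∈ X) k) as [Y HY]; [definability|].
  destruct HW as [[_ [_ [_ [_ [_ H]]]]] _]. destruct (H X Y) as [K|K].
  - intros b Hb. now apply HX.
  - exact HY.
  - left. exists X. split; [exact K|]. intros b Hb. now apply HX.
  - right. exists Y. split; [exact K|]. intros b Hb Pb. apply HY in Hb.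
    apply (proj2 Hb), HX. tauto.
Qed.

Lemma large_neq a : a ∈ k -> large W (fun b => b <> a).
Proof.
  intros Ha. destruct (large_or_not (P := fun b => b = a)) as [[X [HX K]]|H];
    [definability| |exact H].
  (* Otherwise the measure one set X would be the singleton of a, against nonprincipality. *)
  exfalso. destruct HW as [_ [N _]].
  destruct (large_nonempty (P := fun b => b ∈ X)) as [b [_ Hb]].
  { exists X. auto. }
  apply (N a X Ha); [|exact HX]. intros z. split.
  - intros Hz. left. auto.
  - rewrite <- (K b Hb). intros [->| ->]; exact Hb.
Qed.

(** Completeness, applied to the sequence of sections of P that replacement provides. *)
Lemma large_inter (P : U -> U -> Prop) d : definable2 P -> d ∈ k ->
  (forall i, i ∈ d -> large W (P i)) -> large W (fun b => forall i, i ∈ d -> P i b).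
Proof.
  intros HP Hd H. destruct (sections_function d k HP) as [f [Ff Hf]].
  destruct (separation (P := fun b => forall i X, app f i X -> b ∈ X) k) as [B HB];
    [definability|].
  exists B. split.
  - destruct HW as [_ [_ [C _]]]. apply (C d f B Hd Ff); [|exact HB].
    intros i X HX. apply Hf in HX. exact (large_sep (H i (proj1 HX)) (proj2 HX)).
  - intros b Hb i Hi. apply HB in Hb. destruct Hb as [_ Hb].
    destruct (function_app Ff Hi) as [X HX]. specialize (Hb i X HX).
    apply Hf in HX. now apply (proj2 HX).
Qed.

Lemma large_gt a : a ∈ k -> large W (fun b => a ∈ b).
Proof.
  intros Ha.
  assert (H : large W (fun b => forall i, i ∈ a -> b <> i)).
  { apply (large_inter (P := fun i b => b <> i)); [definability|exact Ha|].
    intros i Hi. apply large_neq. exact (ordinal_trans Hk Ha Hi). }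
  generalize (large_dom (large_and H (large_neq Ha))). apply large_mono.
  intros b [Hb [K N]].
  destruct (ordinal_trichotomy (ordinal_mem Hk Ha) (ordinal_mem Hk Hb)) as [L|[L|L]].
  - exact L.
  - now destruct N.
  - now destruct (K b L).
Qed.

Lemma bounded_not_measure a : a ∈ k -> ~ a ∈ W.
Proof.
  intros Ha H. assert (K : large W (fun b => b ∈ a)) by (exists a; auto).
  destruct (large_nonempty (large_and K (large_gt Ha))) as [b [_ [L L']]].
  exact (mem_asym L L').
Qed.

(* By normality, almost no point is a successor. *)
Lemma limit_exists a : a ∈ k ->
  exists l, l ∈ k /\ a ∈ l /\ forall j, j ∈ l -> exists j', j' ∈ l /\ j ∈ j'.
Proof.
  intros Ha.
  destruct (sections_function (P := fun i b => ~ is_succ b i) k k) as [f [Ff Hf]];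
    [definability|].
  destruct (separation (P := fun b => forall i X, i ∈ b -> app f i X -> b ∈ X) k)
    as [B HB]; [definability|].
  assert (WB : B ∈ W).
  { destruct HW as [_ [_ [_ N]]]. apply (N f B Ff); [|exact HB].
    intros i X HX. apply Hf in HX. destruct HX as [Hi HX].
    apply (fun H => large_sep H HX).
    (* The i-th set of the sequence omits at most the point i + 1. *)
    assert (A : large W (fun b => b <> adj i i)).
    { destruct (classic (adj i i ∈ k)) as [A|A]; [now apply large_neq|].
      apply large_all. congruence. }
    revert A. apply large_mono. intros b Nb Hb. now apply is_adjE in Hb. }
  assert (L : large W (fun b => b ∈ B)) by (exists B; auto).
  destruct (large_nonempty (large_and L (large_gt Ha))) as [b [Hb [Bb Hab]]].
  exists b. split; [exact Hb|]. split; [exact Hab|]. intros j Hj.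
  apply HB in Bb. destruct Bb as [_ Bb].
  assert (Hjk := ordinal_trans Hk Hb Hj).
  destruct (function_app Ff Hjk) as [X HX].
  pose proof (Bb j X Hj HX) as K. apply Hf in HX. apply (proj2 HX) in K.
  destruct K as [_ K].
  (* With nothing of b above j, the ordinal b would be the successor of its element j, which
     membership in B forbids. *)
  apply NNPP. intros N. apply K. intros z. split.
  - intros Hz.
    destruct (ordinal_trichotomy (ordinal_mem Hk (ordinal_trans Hk Hb Hz))
                (ordinal_mem Hk Hjk)) as [A|[A|A]]; auto.
    destruct N. exists z. auto.
  - intros [Hz| ->]; [|exact Hj]. exact (ordinal_trans (ordinal_mem Hk Hb) Hj Hz).
Qed.

(* Induction on [d], splitting off the largest element of the finite set. *)
Lemma large_inter_finite d : d ∈ k -> forall P : U -> U -> Prop, definable2 P ->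
  (forall r, finite r -> sub r d -> large W (P r)) ->
  large W (fun b => forall r, finite r -> sub r d -> P r b).
Proof.
  induction (Hwf d) as [d _ IH]. intros Hd P HP H.
  assert (Od := ordinal_mem Hk Hd).
  (* [Q i] takes care of the finite sets with largest element i: such a set is r with i adjoined,
     for a finite subset r of i. *)
  pose (Q := fun i b => forall r, finite r -> sub r i -> forall u, is_adj u r i -> P u b).
  assert (A : large W (fun b => forall i, i ∈ d -> Q i b)).
  { apply large_inter; [unfold Q, is_adj; definability|exact Hd|].
    intros i Hi.
    apply (IH i Hi (ordinal_trans Hk Hd Hi) (fun r b => forall u, is_adj u r i -> P u b)).
    - unfold is_adj; definability.
    - intros r Fr Hr.
      assert (Sr : sub r d) by (intros x Hx; exact (ordinal_trans Od Hi (Hr x Hx))).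
      generalize (H (adj r i) (finite_adj Od Sr Hi Fr)). intros L.
      destruct L as [X [HX K]].
      + intros x Hx. apply mem_adj in Hx. destruct Hx as [Hx| ->]; auto.
      + exists X. split; [exact HX|]. intros b Hb u Hu.
        apply is_adjE in Hu. subst u. auto. }
  assert (B : large W (P empty)).
  { apply H; [apply finite_empty|]. intros x Hx. destruct (not_mem_empty Hx). }
  generalize (large_and A B). apply large_mono. intros b [Kb Eb] r Fr Hr.
  destruct (classic (r = empty)) as [->|N]; [exact Eb|].
  destruct (finite_max Od Hr Fr N) as [m [Hm M]].
  destruct (separation (P := fun x => x ∈ m) r) as [r' Hr']; [definability|].
  apply (Kb m (Hr m Hm) r').
  - apply (finite_sub Od Hr Fr). intros x Hx. now apply Hr'.
  - intros x Hx. now apply Hr'.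
  - intros x. rewrite (Hr' x). split.
    + intros Hx. destruct (M x Hx); auto.
    + intros [[Hx _]| ->]; auto.
Qed.

(** The value of a choice function at a has to cope with all finite subsets of a + 1 at once. Each
    is r or r with a adjoined, for a finite subset r of a, so the previous lemma applies to both
    cases together. *)
Lemma large_inter_finite_succ a (P : U -> U -> Prop) : a ∈ k -> definable2 P ->
  (forall s, finite s -> (forall x, x ∈ s -> x ∈ a \/ x = a) -> large W (P s)) ->
  large W (fun b => forall s, finite s -> (forall x, x ∈ s -> x ∈ a \/ x = a) -> P s b).
Proof.
  intros Ha HP H. assert (Oa := ordinal_mem Hk Ha).
  assert (L : large W (fun b => forall r, finite r -> sub r a ->
    P r b /\ forall s, is_adj s r a -> P s b)).
  { apply large_inter_finite; [exact Ha|unfold is_adj; definability|].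
    intros r Fr Hr. apply large_and.
    - apply H; auto.
    - assert (Sr : sub r k) by (intros x Hx; exact (ordinal_trans Hk Ha (Hr x Hx))).
      assert (K : large W (P (adj r a))).
      { apply H; [exact (finite_adj Hk Sr Ha Fr)|].
        intros x Hx. apply mem_adj in Hx. destruct Hx as [Hx| ->]; auto. }
      revert K. apply large_mono. intros b Pb s Hs. apply is_adjE in Hs. now subst. }
  revert L. apply large_mono. intros b Kb s Fs Hs.
  destruct (classic (a ∈ s)) as [Sa|Na].
  - destruct (separation (P := fun x => x ∈ a) s) as [r Hr]; [definability|].
    assert (Sk : sub s k).
    { intros x Hx. destruct (Hs x Hx) as [K| ->]; [|exact Ha].
      exact (ordinal_trans Hk Ha K). }
    apply (proj2 (Kb r (finite_sub (s' := r) Hk Sk Fs (fun x Hx => proj1 (proj1 (Hr x) Hx)))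
                     (fun x Hx => proj2 (proj1 (Hr x) Hx)))).
    intros x. rewrite (Hr x). split.
    + intros Hx. destruct (Hs x Hx); auto.
    + intros [[Hx _]| ->]; auto.
  - apply Kb; [exact Fs|]. intros x Hx. destruct (Hs x Hx) as [K| ->]; tauto.
Qed.

End Measure.

(** * The forcing *)

(* b ∈ F(a) *)
Definition value (F a b : U) : Prop := exists A, app F a A /\ b ∈ A.

Section Forcing.
Variables kappa mu : U.
Hypothesis Hkappa : infinite_cardinal kappa.
Hypothesis Hmu : distinct_normal_measures kappa mu.

Lemma kappa_ordinal : ordinal kappa.
Proof. apply Hkappa. Qed.

Lemma mu_measure a W : app mu a W -> normal_measure W kappa.
Proof. apply Hmu. Qed.

(** Every choice function constructed below arises here, from a definable relation that holds almost
    everywhere in its second argument. *)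
Lemma choice_function_exists (P : U -> U -> Prop) : definable2 P ->
  (forall a W, a ∈ kappa -> app mu a W -> large W (P a)) ->
  exists F, choice_function kappa mu F /\
    forall a b, value F a b <-> a ∈ kappa /\ b ∈ kappa /\ P a b.
Proof.
  intros HP H. destruct (sections_function kappa kappa HP) as [F [FF E]].
  exists F. split; [split; [exact FF|]|].
  - intros a A W HA HW. apply E in HA. destruct HA as [Ha HA].
    exact (large_sep (mu_measure HW) (H a W Ha HW) HA).
  - intros a b. split.
    + intros [A [HA Hb]]. apply E in HA. destruct HA as [Ha HA].
      apply HA in Hb. tauto.
    + intros [Ha Hb]. destruct (function_app FF Ha) as [A HA].
      exists A. split; [exact HA|]. apply E in HA. now apply (proj2 HA).
Qed.

Lemma choice_function_large F a W :
  choice_function kappa mu F -> app mu a W -> large W (value F a).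
Proof.
  intros [FF HF] HW.
  assert (Ha : a ∈ kappa) by exact (function_app_dom (proj1 Hmu) HW).
  destruct (function_app FF Ha) as [A HA]. exists A.
  split; [exact (HF a A W HA HW)|]. intros b Hb. exists A. auto.
Qed.

Lemma value_dom F a b : choice_function kappa mu F -> value F a b -> b ∈ kappa.
Proof.
  intros [FF HF] [A [HA Hb]].
  destruct (function_app (proj1 Hmu) (function_app_dom FF HA)) as [W HW].
  exact (measure_sub (mu_measure HW) (HF a A W HA HW) Hb).
Qed.

Definition refines (F' F : U) : Prop := forall a b, value F' a b -> value F a b.

Lemma common_refinement F H : choice_function kappa mu F -> choice_function kappa mu H ->
  exists K, choice_function kappa mu K /\
    forall a b, value K a b <-> value F a b /\ value H a b.
Proof.
  intros HF HH.
  destruct (choice_function_exists (P := fun a b => value F a b /\ value H a b))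
    as [K [HK E]].
  - unfold value; definability.
  - intros a W _ HW. apply (large_and (mu_measure HW)); now apply choice_function_large.
  - exists K. split; [exact HK|]. intros a b. rewrite E. split; [tauto|].
    intros [V1 V2]. split; [|split; [exact (value_dom HF V1)|tauto]].
    destruct V1 as [A [HA _]]. exact (function_app_dom (proj1 HF) HA).
Qed.

Lemma refinesP F F' : function_on F kappa -> function_on F' kappa ->
  refines F' F <->
  forall a A A', app F a A -> app F' a A' -> sub A' A.
Proof.
  intros FF FF'. split.
  - intros H a A A' HA HA' b Hb. destruct (H a b) as [A2 [HA2 Hb2]].
    + exists A'. auto.
    + now rewrite (function_app_unique FF HA HA2).
  - intros H a b [A' [HA' Hb]].
    destruct (function_app FF (function_app_dom FF' HA')) as [A HA].
    exists A. split; [exact HA|]. exact (H a A A' HA HA' b Hb).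
Qed.

(** Clause (c) of the order for prolonging [fset n g] to [fset m g]. It is used with 0 < n, so that
    i - 1 is a true predecessor. *)
Definition follows (F : U) (n m : nat) (g : nat -> U) : Prop :=
  forall i, n <= i -> i < m -> value F (g (i - 1)) (g i).

Lemma fset_max n g : 0 < n -> incr n g -> is_max (g (n - 1)) (fset n g).
Proof.
  intros Hn Hg. split.
  - apply mem_fset. exists (n - 1). split; [lia|reflexivity].
  - intros x Hx. apply mem_fset in Hx. destruct Hx as [i [Hi ->]].
    destruct (Nat.eq_dec i (n - 1)) as [->|N]; [now right|]. left. apply Hg; lia.
Qed.

Lemma is_max_unique s x y : is_max x s -> is_max y s -> x = y.
Proof.
  intros [Hx Mx] [Hy My]. destruct (Mx y Hy) as [H|H]; [|now symmetry].
  destruct (My x Hx) as [K|K]; [|exact K]. destruct (mem_asym H K).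
Qed.

Lemma stronger_intro n m g F F' : 0 < n -> n <= m -> incr m g ->
  choice_function kappa mu F -> choice_function kappa mu F' ->
  refines F' F -> follows F n m g ->
  stronger (pair (fset m g) F') (pair (fset n g) F).
Proof.
  intros Hn Hm Hg [FF _] [FF' _] R Fo.
  exists (fset n g), F, (fset m g), F'.
  split; [now apply is_opairE|]. split; [now apply is_opairE|].
  split; [split|split].
  - intros x Hx. apply mem_fset in Hx. destruct Hx as [i [Hi ->]].
    apply mem_fset. exists i. split; [lia|reflexivity].
  - exists (g (n - 1)), (adj (g (n - 1)) (g (n - 1))).
    split; [apply (fset_max Hn (incr_le Hm Hg))|].
    split; [intros z; apply mem_adj|].
    intros x. rewrite !mem_fset, mem_adj. split.
    + intros [i [Hi ->]]. split; [exists i; split; [lia|reflexivity]|].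
      destruct (Nat.eq_dec i (n - 1)) as [->|N]; [now right|]. left. apply Hg; lia.
    + intros [[i [Hi ->]] H]. exists i. split; [|reflexivity].
      destruct H as [H|H].
      * apply (incr_lt Hg) in H; lia.
      * apply (incr_inj Hg) in H; lia.
  - now apply refinesP.
  - intros x i j a b Hx Hxi Hij Hi Hj.
    apply (has_size_fset _ (incr_le Hm Hg)) in Hx. subst x.
    apply (nth_element_fset _ _ Hg) in Hi, Hj.
    destruct Hi as [i' [Hi' [-> ->]]], Hj as [j' [Hj' [-> ->]]].
    apply is_succ_num, num_inj in Hij. subst i'.
    pose proof (Fo (S j')) as V. replace (S j' - 1) with j' in V by lia.
    apply V; [|exact Hi'].
    destruct Hxi as [H|H]; [apply num_mem_lt in H; lia|apply num_inj in H; lia].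
Qed.

(** By clause (a) the shorter set is an initial segment of the longer one, so it is enumerated by
    the same g. *)
Lemma stronger_elim m g s F F' : incr m g ->
  choice_function kappa mu F -> choice_function kappa mu F' ->
  stronger (pair (fset m g) F') (pair s F) ->
  exists n, 0 < n /\ n <= m /\ s = fset n g /\ refines F' F /\ follows F n m g.
Proof.
  intros Hg [FF _] [FF' _] [s1 [F1 [s2 [F2 [E1 [E2 [[Hs [x [t [Hx [Ht Hst]]]]] [HR HF]]]]]]]].
  apply is_opairE, pair_inj in E1, E2.
  destruct E1 as [<- <-], E2 as [<- <-].
  (* If the maximum of s is g k, then s consists of the first k + 1 values of g. *)
  pose proof (Hs x (proj1 Hx)) as Kx. apply mem_fset in Kx.
  destruct Kx as [k [Hk ->]].
  assert (E : s = fset (S k) g).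
  { apply set_ext. intros z. rewrite (Hst z), (Ht z), !mem_fset. split.
    - intros [[i [Hi ->]] H]. exists i. split; [|reflexivity].
      destruct H as [H|H].
      + apply (incr_lt Hg) in H; lia.
      + apply (incr_inj Hg) in H; lia.
    - intros [i [Hi ->]]. split; [exists i; split; [lia|reflexivity]|].
      destruct (Nat.eq_dec i k) as [->|N]; [now right|]. left. apply Hg; lia. }
  exists (S k). repeat split; [lia|lia|exact E|now apply refinesP|].
  intros i Hi Him.
  apply (HF (num (S k)) (num i) (num (i - 1))).
  - rewrite E. apply has_size_fset; [apply (incr_le Hk Hg)|reflexivity].
  - destruct (Nat.eq_dec (S k) i) as [->|N]; [now right|]. left. apply num_lt. lia.
  - apply is_succ_num. f_equal. lia.
  - apply nth_element_fset; [exact Hg|]. exists i. auto.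
  - apply nth_element_fset; [exact Hg|]. exists (i - 1). split; [lia|auto].
Qed.

Lemma conditionE p : condition kappa mu p <->
  exists n g F, 0 < n /\ incr n g /\ (forall i, i < n -> g i ∈ kappa) /\
    choice_function kappa mu F /\ p = pair (fset n g) F.
Proof.
  split.
  - intros [s [F [Hp [Hs [Fs [Ns HF]]]]]]. apply is_opairE in Hp.
    destruct (finite_enumeration kappa_ordinal Hs Fs) as [n [g [Hg ->]]].
    exists n, g, F. repeat split; auto; try apply HF.
    + destruct n; [destruct Ns; exact is_empty_empty|lia].
    + intros i Hi. apply Hs, mem_fset. eauto.
  - intros [n [g [F [Hn [Hg [Hk [HF ->]]]]]]]. exists (fset n g), F.
    split; [now apply is_opairE|]. split.
    { intros x Hx. apply mem_fset in Hx. destruct Hx as [i [Hi ->]]. auto. }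
    split; [now apply finite_fset|]. split; [|exact HF].
    intros N. apply (N (g 0)), mem_fset. exists 0. auto.
Qed.

(** Genericity concerns dense sets that are elements of the model; this bound is what they are
    separated from. *)
Lemma conditions_bound : exists C, forall p, condition kappa mu p -> p ∈ C.
Proof.
  destruct (zfc_powerset HZ kappa) as [P HP].
  destruct (product_bound kappa P) as [Q HQ].
  destruct (zfc_powerset HZ Q) as [PQ HPQ].
  destruct (product_bound P PQ) as [C HC].
  exists C. intros p [s [F [Hp [Hs [_ [_ [FF HF]]]]]]]. apply is_opairE in Hp. subst p.
  apply HC; [now apply HP|]. apply HPQ. intros q Hq.
  destruct (proj1 FF q Hq) as [a [A [Ha E]]].
  assert (HA : app F a A) by (exists q; auto).
  apply is_opairE in E. subst q. apply HQ; [exact Ha|]. apply HP.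
  destruct (function_app (proj1 Hmu) Ha) as [W HW].
  exact (measure_sub (mu_measure HW) (HF a A W HA HW)).
Qed.

Lemma incr_all (g : nat -> U) n : (forall i j, i < j -> g i ∈ g j) -> incr n g.
Proof. intros H i j Hij _. auto. Qed.

(** * Generic sequences eventually follow every choice function *)

Section Sequence.
Variable g : nat -> U.
Hypothesis Hgk : forall i, g i ∈ kappa.
Hypothesis Hg : forall i j, i < j -> g i ∈ g j.

Lemma generic_follows (G : U -> Prop) F :
  generic_filter kappa mu G ->
  (forall n, 0 < n -> exists K, G (pair (fset n g) K)) ->
  choice_function kappa mu F ->
  exists n, 0 < n /\ forall i, n <= i -> value F (g (i - 1)) (g i).
Proof.
  intros [[Gc [_ [_ Gd]]] Gg] GS HF.
  destruct conditions_bound as [C HC].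
  (* D consists of the conditions whose choice function refines F; it is dense by
     [common_refinement]. *)
  destruct (separation (P := fun p => condition kappa mu p /\
    exists s H, is_opair p s H /\ refines H F) C) as [D HD].
  { unfold refines, value. definability. }
  destruct (Gg D) as [p [Gp Dp]].
  { split; [intros p Hp; now apply HD|]. intros p Hp.
    apply conditionE in Hp. destruct Hp as [n [h [H [Hn [Hh [Hk [HH ->]]]]]]].
    destruct (common_refinement HF HH) as [K [HK E]].
    assert (cK : condition kappa mu (pair (fset n h) K))
      by (apply conditionE; exists n, h, K; auto).
    exists (pair (fset n h) K). split.
    - apply HD. split; [auto|]. split; [exact cK|]. exists (fset n h), K.
      split; [now apply is_opairE|]. intros a b V. now apply E.
    - apply stronger_intro; auto.
      + intros a b V. now apply E.
      + intros i Hi Hi'. lia. }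
  apply HD in Dp. destruct Dp as [_ [cp [s [H [Ep R]]]]].
  apply is_opairE in Ep. subst p.
  apply conditionE in cp. destruct cp as [n [h [H' [Hn [Hh [_ [HH E]]]]]]].
  apply pair_inj in E. destruct E as [-> <-].
  exists n. split; [exact Hn|]. intros i Hi.
  (* A common extension r of p and of a condition with set [fset (S i) g] has an enumeration f that
     agrees with g up to i and follows H from n on. This gives the claim at i. *)
  destruct (GS (S i)) as [K GK]; [lia|].
  destruct (Gd _ _ Gp GK) as [r [Gr [S1 S2]]].
  destruct (proj1 (conditionE _) (Gc _ GK)) as [n1 [h1 [K1 [_ [_ [_ [HK E]]]]]]].
  apply pair_inj in E. destruct E as [_ <-].
  destruct (proj1 (conditionE _) (Gc _ Gr)) as [m [f [L [Hm [Hf [_ [HL ->]]]]]]].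
  destruct (stronger_elim Hf HH HL S1) as [n2 [_ [Hn2 [E2 [_ Fo]]]]].
  destruct (stronger_elim Hf HK HL S2) as [n3 [_ [Hn3 [E3 _]]]].
  destruct (enumeration_unique Hh (incr_le Hn2 Hf) E2) as [<- _].
  destruct (enumeration_unique (incr_all (n := S i) Hg) (incr_le Hn3 Hf) E3) as [<- E].
  apply R. rewrite (E i), (E (i - 1)) by lia. apply Fo; lia.
Qed.

End Sequence.

(** * Meeting a dense set: decided sets and their ranks *)

Section Genericity.
Variable D : U.
Hypothesis HD : dense kappa mu D.

Definition decided (s : U) : Prop := exists F, app D s F.

(** The F_s have to be chosen inside the model, because a choice function is later defined from all
    of them. Choice is applied to the fibers of D over the first coordinate, which are nonempty and
    pairwise disjoint. *)
Lemma selector_exists : exists c,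
  (forall s F, app c s F -> app D s F) /\
  (forall s, decided s -> exists F, app c s F) /\
  (forall s F F', app c s F -> app c s F' -> F = F').
Proof.
  destruct (zfc_powerset HZ D) as [PD HPD].
  pose (fiber := fun z s => forall p, p ∈ z <-> p ∈ D /\ exists H, is_opair p s H).
  destruct (separation (P := fun z => exists s, (exists F, app D s F) /\ fiber z s) PD)
    as [a Ha].
  { unfold fiber; definability. }
  destruct (zfc_choice HZ (a := a)) as [c Hc].
  - intros z Hz. apply Ha in Hz. destruct Hz as [_ [s [[F [p [Hp K]]] Hz]]].
    exists p. apply Hz. eauto.
  - intros x y p Hx Hy Px Py. apply Ha in Hx, Hy.
    destruct Hx as [_ [s [_ Hx]]], Hy as [_ [t [_ Hy]]].
    apply Hx in Px as [_ [H K]]. apply Hy in Py as [_ [H' K']].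
    apply is_opairE in K, K'. subst p. apply pair_inj in K'. destruct K' as [-> _].
    apply set_ext. intros z. rewrite (Hx z), (Hy z). reflexivity.
  - assert (E : forall s, decided s -> exists F, app D s F /\ pair s F ∈ c /\
      forall F', app D s F' -> pair s F' ∈ c -> F = F').
    { intros s Gs.
      destruct (separation (P := fun p => exists H, is_opair p s H) D) as [z Hz];
        [definability|].
      destruct (Hc z) as [p [[Pz Pc] Pu]].
      - apply Ha. split; [apply HPD; intros q Hq; now apply Hz|].
        exists s. split; [exact Gs|exact Hz].
      - apply Hz in Pz. destruct Pz as [PD' [F HF]]. apply is_opairE in HF. subst p.
        exists F. split; [now apply appE|]. split; [exact Pc|].
        intros F' HF' HC. apply (pair_inj (a := s) (c := s)), Pu. split; [|exact HC].
        apply Hz. split; [now apply appE|]. exists F'. now apply is_opairE. }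
    (* The choice set may contain junk outside D, which is removed here. *)
    destruct (separation (P := fun p => p ∈ c) D) as [c' Hc']; [definability|].
    assert (A : forall s F, app c' s F <-> app D s F /\ pair s F ∈ c)
      by (intros s F; rewrite !appE; apply Hc').
    exists c'. split; [|split].
    + intros s F H. now apply A.
    + intros s Gs. destruct (E s Gs) as [F HF]. exists F. apply A. tauto.
    + intros s F F' H H'. apply A in H, H'.
      destruct (E s) as [F0 [_ [_ K]]]; [exists F; tauto|].
      rewrite <- (K F), <- (K F'); tauto.
Qed.

Lemma decided_choice s F : app D s F -> choice_function kappa mu F.
Proof.
  intros [p [Hp E]]. apply HD in Hp. apply conditionE in Hp.
  destruct Hp as [n [g [F' [_ [_ [_ [HF ->]]]]]]].
  apply is_opairE, pair_inj in E. now destruct E as [_ <-].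
Qed.

(** An ambient set for rank relations, containing all pairs of subsets of [kappa]. *)
Variable Q : U.
Hypothesis HQ : forall s j, sub s kappa -> sub j kappa -> pair s j ∈ Q.

(** Read [app R t j] as: t has rank at most j. An undecided t must then have, for some i below j,
    rank at most i at almost all its one-point extensions. *)
Definition progressive (R : U) : Prop :=
  forall t j, app R t j -> decided t \/
    exists i m W X, i ∈ j /\ is_max m t /\ app mu m W /\ X ∈ W /\
      forall b, b ∈ X -> exists u, is_adj u t b /\ app R u i.

(* The union of the progressive subsets of [Q] is the largest one; coding the
   ranks this way avoids recursion inside the model. *)
Definition ranked (s j : U) : Prop :=
  exists R, sub R Q /\ progressive R /\ app R s j.

Definition steps_down (s j : U) : Prop :=
  exists i m W, i ∈ j /\ is_max m s /\ app mu m W /\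
    large W (fun b => ranked (adj s b) i).

Lemma definable_decided : definable1 decided.
Proof. unfold decided; definability. Qed.

Lemma definable_ranked : definable2 ranked.
Proof. unfold ranked, progressive, decided, is_adj; definability. Qed.

Lemma ranked_elim s j : ranked s j -> decided s \/ steps_down s j.
Proof.
  intros [R [RQ [HR Hs]]]. destruct (HR s j Hs) as [H|H]; [now left|right].
  destruct H as [i [m [W [X [Hi [Hm [HW [HX K]]]]]]]].
  exists i, m, W. repeat split; auto; try apply Hm.
  exists X. split; [exact HX|]. intros b Hb. destruct (K b Hb) as [u [Hu Ru]].
  apply is_adjE in Hu. subst u. exists R. auto.
Qed.

(** Adjoining the pair (s, j) to the union of all progressive subsets of Q leaves it progressive,
    because the ranks that s needs are already there. *)
Lemma ranked_intro s j : sub s kappa -> sub j kappa ->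
  decided s \/ steps_down s j -> ranked s j.
Proof.
  intros Ss Sj H.
  destruct (separation (P := fun p => (exists R, sub R Q /\ progressive R /\ p ∈ R)
    \/ is_opair p s j) Q) as [R HR].
  { unfold progressive, decided, is_adj; definability. }
  assert (A : forall t i, ranked t i -> app R t i).
  { intros t i [R' [RQ [HR' K]]]. apply appE, HR. apply appE in K.
    split; [now apply RQ|]. left. exists R'. auto. }
  assert (B : forall t i, app R t i -> ranked t i \/ t = s /\ i = j).
  { intros t i K. apply appE, HR in K. destruct K as [_ [[R' [RQ [HR' K]]]|K]].
    - left. exists R'. split; [exact RQ|]. split; [exact HR'|]. now apply appE.
    - right. now apply is_opairE, pair_inj in K. }
  exists R. split; [|split].
  - intros p Hp. now apply HR.
  - intros t i K.
    assert (C : decided t \/ steps_down t i).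
    { destruct (B t i K) as [C|[-> ->]]; [now apply ranked_elim|exact H]. }
    destruct C as [C|[i' [m [W [Hi [Hm [HW [X [HX C]]]]]]]]]; [now left|right].
    exists i', m, W, X. repeat split; auto; try apply Hm.
    intros b Hb. exists (adj t b). split; [now apply is_adjE|]. apply A, C, Hb.
  - apply appE, HR. split; [now apply HQ|]. right. now apply is_opairE.
Qed.

(** Ranks range over l: being below [kappa], it allows completeness to treat all ranks at once, and
    being a limit, it leaves room for one more step. *)
Variable l : U.
Hypothesis Hl : l ∈ kappa.
Hypothesis Hl_ne : exists j, j ∈ l.
Hypothesis Hl_lim : forall j, j ∈ l -> exists j', j' ∈ l /\ j ∈ j'.

Definition unranked (s : U) : Prop := forall j, j ∈ l -> ~ ranked s j.

Lemma sub_kappa j : j ∈ l -> sub j kappa.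
Proof.
  intros Hj x Hx. pose proof kappa_ordinal as Ok.
  exact (ordinal_trans Ok (ordinal_trans Ok Hl Hj) Hx).
Qed.

Lemma definable_unranked : definable1 unranked.
Proof. pose proof definable_ranked. unfold unranked; definability. Qed.

Lemma unranked_extension s m W : sub s kappa -> is_max m s -> app mu m W ->
  unranked s -> large W (fun b => unranked (adj s b)).
Proof.
  intros Ss Hm HW Hs. pose proof (mu_measure HW) as MW. pose proof definable_ranked.
  pose (P := fun j b => exists u, is_adj u s b /\ ranked u j).
  assert (L : large W (fun b => forall j, j ∈ l -> ~ P j b)).
  { apply (large_inter MW (P := fun j b => ~ P j b)); [|exact Hl|].
    - unfold P, is_adj; definability.
    - intros j Hj. destruct (large_or_not MW (P := P j)) as [L|L]; [|exfalso|exact L].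
      + unfold P, is_adj; definability.
      (* If almost all extensions had rank j, then s itself would have the larger rank j', still
         below l. *)
      + destruct (Hl_lim Hj) as [j' [Hj' K]]. apply (Hs j' Hj').
        apply (ranked_intro Ss (sub_kappa Hj')). right. exists j, m, W.
        repeat split; auto; try apply Hm.
        revert L. apply large_mono. intros b [u [Hu Ru]].
        apply is_adjE in Hu. now subst. }
  revert L. apply large_mono. intros b Hb j Hj Rj. apply (Hb j Hj).
  exists (adj s b). split; [now apply is_adjE|exact Rj].
Qed.

Lemma sub_fset n g : (forall i, i < n -> g i ∈ kappa) -> sub (fset n g) kappa.
Proof.
  intros H x Hx. apply mem_fset in Hx. destruct Hx as [i [Hi ->]]. auto.
Qed.

Lemma all_ranked n g : 0 < n -> incr n g -> (forall i, i < n -> g i ∈ kappa) ->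
  exists j, j ∈ l /\ ranked (fset n g) j.
Proof.
  intros Hn Hg Hk. apply NNPP. intros N. pose proof definable_unranked.
  assert (LN : unranked (fset n g)) by (intros j Hj R; apply N; eauto).
  (* Vacuous unless s is unranked with maximum a, so that F a keeps all these s unranked
     simultaneously. *)
  pose (P := fun a s b => is_max a s -> unranked s -> forall u, is_adj u s b -> unranked u).
  destruct (choice_function_exists (P := fun a b => forall s, finite s ->
    (forall x, x ∈ s -> x ∈ a \/ x = a) -> P a s b)) as [F [HF EF]].
  - unfold P, is_adj. definability.
  - intros a W Ha HW.
    apply (large_inter_finite_succ kappa_ordinal (mu_measure HW)); [exact Ha| |].
    + unfold P, is_adj. definability.
    + intros s Fs Hs. destruct (classic (is_max a s /\ unranked s)) as [[M Ls]|K].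
      * assert (Ss : sub s kappa).
        { intros x Hx. destruct (Hs x Hx) as [K| ->]; [|exact Ha].
          exact (ordinal_trans kappa_ordinal Ha K). }
        generalize (unranked_extension Ss M HW Ls). apply large_mono.
        intros b Hb _ _ u Hu. apply is_adjE in Hu. now subst.
      * apply (large_all (mu_measure HW)). intros b _ M Ls. tauto.
  - destruct (proj2 HD (pair (fset n g) F)) as [q [Dq Sq]].
    { apply conditionE. exists n, g, F. auto. }
    assert (cq := proj1 HD q Dq). apply conditionE in cq.
    destruct cq as [m [h [H' [Hm [Hh [Kh [HH ->]]]]]]].
    destruct (stronger_elim Hh HF HH Sq) as [n' [Hn' [Hm' [E [_ Fo]]]]].
    rewrite E in LN.
    (* Along a condition of D below (s, F), being unranked is passed from each initial segment to
       the next. Yet the last one is decided and therefore has every rank. *)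
    assert (A : forall i, n' <= i -> i <= m -> unranked (fset i h)).
    { intros i Hi. induction Hi as [|i Hi IH]; intros Lm; [exact LN|].
      pose proof (Fo i Hi Lm) as V. apply EF in V. destruct V as [_ [_ V]].
      assert (Hi0 : 0 < i) by lia.
      assert (Hih : incr i h) by (apply (incr_le (m := m)); [lia|exact Hh]).
      pose proof (fset_max Hi0 Hih) as M.
      apply (V (fset i h)).
      - now apply finite_fset.
      - apply M.
      - exact M.
      - apply IH. lia.
      - now apply is_adjE. }
    destruct Hl_ne as [j Hj]. apply (A m Hm' (le_n m) j Hj).
    apply (ranked_intro (sub_fset Kh) (sub_kappa Hj)).
    left. exists H'. now apply appE.
Qed.

Lemma meets_dense (g : nat -> U) :
  (forall i, g i ∈ kappa) -> (forall i j, i < j -> g i ∈ g j) ->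
  (forall F, choice_function kappa mu F ->
     exists n, 0 < n /\ forall i, n <= i -> value F (g (i - 1)) (g i)) ->
  exists n F, 0 < n /\ app D (fset n g) F /\
    forall i, n <= i -> value F (g (i - 1)) (g i).
Proof.
  intros Gk Gi HC.
  destruct selector_exists as [c [cD [cE cU]]].
  pose proof definable_ranked. pose proof definable_decided.
  (* [P1] puts F a inside F_s(a) for each decided s included in a + 1. [P2] makes a step along F
     lower any rank below l of an undecided s with maximum a. *)
  pose (P1 := fun a s b => forall F, app c s F -> value F a b).
  pose (P2 := fun a s b => forall j, j ∈ l -> is_max a s -> ranked s j -> ~ decided s ->
    forall u, is_adj u s b -> exists i, i ∈ j /\ ranked u i).
  destruct (choice_function_exists (P := fun a b => forall s, finite s ->
    (forall x, x ∈ s -> x ∈ a \/ x = a) -> P1 a s b /\ P2 a s b)) as [F [HF EF]].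
  - unfold P1, P2, is_adj, value. definability.
  - intros a W Ha HW. pose proof (mu_measure HW) as MW.
    apply (large_inter_finite_succ kappa_ordinal MW); [exact Ha| |].
    + unfold P1, P2, is_adj, value. definability.
    + intros s Fs Hs. apply (large_and MW).
      * destruct (classic (decided s)) as [Gs|Ns].
        -- destruct (cE s Gs) as [F HF].
           generalize (choice_function_large (decided_choice (cD s F HF)) HW).
           apply large_mono. intros b Vb F' HF'. now rewrite (cU _ _ _ HF' HF).
        -- apply (large_all MW). intros b _ F HF. destruct Ns. exists F. auto.
      (* All ranks j below l are treated together, by completeness. *)
      * apply (large_inter MW (P := fun j b => is_max a s -> ranked s j ->
          ~ decided s -> forall u, is_adj u s b -> exists i, i ∈ j /\ ranked u i));
          [unfold is_adj; definability|exact Hl|].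
        intros j Hj.
        destruct (classic (is_max a s /\ ranked s j /\ ~ decided s)) as [[M [R Ns]]|K].
        -- destruct (ranked_elim R) as [K|[i [m [W' [Hi [Hm [HW' L]]]]]]]; [tauto|].
           rewrite (is_max_unique Hm M) in HW'.
           rewrite (function_app_unique (proj1 Hmu) HW' HW) in L.
           revert L. apply large_mono. intros b Rb _ _ _ u Hu.
           apply is_adjE in Hu. subst u. eauto.
        -- apply (large_all MW). tauto.
  - destruct (HC F HF) as [n [Hn Fo]].
    (* Induction on the rank j takes place outside the model, as it must: the sequence g need not
       belong to it. *)
    assert (A : forall j, j ∈ l -> forall m, n <= m -> ranked (fset m g) j ->
      exists m', n <= m' /\ decided (fset m' g)).
    { intros j. induction (Hwf j) as [j _ IH]. intros Hj m Hm R.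
      destruct (classic (decided (fset m g))) as [Gm|Nm]; [eauto|].
      pose proof (Fo m Hm) as V. apply EF in V. destruct V as [_ [_ V]].
      assert (Hm0 : 0 < m) by lia.
      pose proof (fset_max Hm0 (incr_all (n := m) Gi)) as M.
      destruct (proj2 (V (fset m g) (finite_fset (incr_all (n := m) Gi)) (proj2 M))
                  j Hj M R Nm (fset (S m) g)) as [i [Hi Ri]].
      - now apply is_adjE.
      - apply (IH i Hi (ordinal_trans (ordinal_mem kappa_ordinal Hl) Hj Hi) (S m)); auto. }
    destruct (all_ranked Hn (incr_all (n := n) Gi) (fun i _ => Gk i)) as [j [Hj R]].
    destruct (A j Hj n (le_n n) R) as [m [Hm Gm]].
    destruct (cE _ Gm) as [H' HH]. exists m, H'. split; [lia|].
    split; [now apply cD|]. intros i Hi.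
    (* As m <= i, the decided set [fset m g] is included in g (i - 1) + 1, so [P1] applies at g (i -
       1). *)
    assert (Hni : n <= i) by lia.
    pose proof (Fo i Hni) as V. apply EF in V. destruct V as [_ [_ V]].
    apply (V (fset m g)); [apply finite_fset, incr_all, Gi| |exact HH].
    intros x Hx. apply mem_fset in Hx. destruct Hx as [k [Hk ->]].
    destruct (Nat.eq_dec k (i - 1)) as [->|Nk]; [now right|]. left. apply Gi. lia.
Qed.

End Genericity.
(** F(a) has measure one, whereas a is a bounded subset of [kappa]. This settles the ambiguous
    ordered pairs met in [value_val]. *)
Lemma choice_function_app_irrefl F a : choice_function kappa mu F -> ~ app F a a.
Proof.
  intros [FF HF] H. pose proof (function_app_dom FF H) as Ha.
  destruct (function_app (proj1 Hmu) Ha) as [W HW].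
  exact (bounded_not_measure kappa_ordinal (mu_measure HW) Ha (HF a a W H HW)).
Qed.

Lemma kappa_limit : exists l, l ∈ kappa /\ (exists j, j ∈ l) /\
  forall j, j ∈ l -> exists j', j' ∈ l /\ j ∈ j'.
Proof.
  assert (Ne : exists a, a ∈ kappa).
  { apply NNPP. intros N. apply (proj2 (proj2 Hkappa)).
    replace kappa with empty; [apply finite_empty|]. apply set_ext. intros z.
    split; intros Hz; [destruct (not_mem_empty Hz)|destruct N; eauto]. }
  destruct Ne as [a Ha]. destruct (function_app (proj1 Hmu) Ha) as [W HW].
  destruct (limit_exists kappa_ordinal (mu_measure HW) Ha) as [l [Hl [Hal L]]].
  exists l. split; [exact Hl|]. split; [now exists a|exact L].
Qed.

(** Both g and G are external to the model; only the values of g and the members of G lie in it. *)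
Theorem generic_sequence_characterization (g : nat -> U) :
  (forall i, g i ∈ kappa) -> (forall i j, i < j -> g i ∈ g j) ->
  (exists G, generic_filter kappa mu G /\
     forall n, 0 < n -> exists p s K, G p /\ is_opair p s K /\
       forall x, x ∈ s <-> exists i, i < n /\ x = g i) <->
  (forall F, choice_function kappa mu F ->
     exists n, 0 < n /\ forall i, n <= i -> value F (g (i - 1)) (g i)).
Proof.
  intros Gk Gi. split.
  - intros [G [GG GS]] F HF. apply (generic_follows Gi GG); [|exact HF].
    intros n Hn. destruct (GS n Hn) as [p [s [K [Gp [E Hs]]]]].
    apply is_opairE in E. subst p. exists K.
    replace (fset n g) with s; [exact Gp|].
    apply set_ext. intros x. rewrite Hs, mem_fset. reflexivity.
  - intros HC.
    pose (G := fun p => exists n F, 0 < n /\ choice_function kappa mu F /\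
      p = pair (fset n g) F /\ forall i, n <= i -> value F (g (i - 1)) (g i)).
    assert (GI : forall n, incr n g) by (intros n; apply incr_all, Gi).
    assert (Gc : forall p, G p -> condition kappa mu p).
    { intros p [n [F [Hn [HF [-> _]]]]]. apply conditionE. exists n, g, F. auto. }
    (* T is the largest choice function, with constant value [kappa]. Any sequence in [kappa]
       follows it, so every nonempty initial segment of g occurs in G. *)
    destruct (choice_function_exists (P := fun _ _ => ~ False)) as [T [HT ET]].
    { definability. }
    { intros a W _ HW. apply (large_all (mu_measure HW)). auto. }
    assert (GT : forall n, 0 < n -> G (pair (fset n g) T)).
    { intros n Hn. exists n, T. repeat split; auto; try apply HT.
      intros i _. apply ET. auto. }
    exists G. split; [split; [split; [exact Gc|split; [|split]]|]|].
    + exists (pair (fset 1 g) T). apply GT. lia.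
    + intros p q [n [F [Hn [HF [-> Fo]]]]] cq Sq.
      apply conditionE in cq. destruct cq as [k [h [H [_ [_ [_ [HH ->]]]]]]].
      destruct (stronger_elim (GI n) HH HF Sq) as [m [Hm [Hmn [-> [R Fo']]]]].
      exists m, H. repeat split; auto; try apply HH.
      (* Before n the sequence follows H by clause (c) of the order, and from n on because it
         follows F, which refines H. *)
      intros i Hi. destruct (Nat.lt_ge_cases i n) as [L|L]; [now apply Fo'|].
      apply R, Fo, L.
    + intros p q [n [F [Hn [HF [-> Fo]]]]] [m [H [Hm [HH [-> Fo']]]]].
      destruct (common_refinement HF HH) as [K [HK EK]].
      exists (pair (fset (Nat.max n m) g) K). split; [|split].
      * exists (Nat.max n m), K. repeat split; try apply HK; [lia|].
        intros i Hi. apply EK. split; [apply Fo|apply Fo']; lia.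
      * apply stronger_intro; auto; [lia|intros a b V; now apply EK|].
        intros i Hi _. now apply Fo.
      * apply stronger_intro; auto; [lia|intros a b V; now apply EK|].
        intros i Hi _. now apply Fo'.
    + intros D HD.
      destruct (zfc_powerset HZ kappa) as [P HP].
      destruct (product_bound P P) as [Q HQ].
      assert (HQ' : forall s j, sub s kappa -> sub j kappa -> pair s j ∈ Q)
        by (intros s j Hs Hj; apply HQ; now apply HP).
      destruct kappa_limit as [l [Hl [Ne Lim]]].
      destruct (meets_dense HD HQ' Hl Ne Lim Gk Gi HC) as [n [F [Hn [DF Fo]]]].
      exists (pair (fset n g) F). split; [|now apply appE].
      exists n, F. pose proof (decided_choice HD DF). auto.
    + intros n Hn. exists (pair (fset n g) T), (fset n g), T.
      split; [now apply GT|]. split; [now apply is_opairE|]. intros x. apply mem_fset.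
Qed.

End Forcing.

End SetTheory.

(** * Absoluteness *)

Section Absoluteness.
Variable V : set_structure.
Hypothesis Vext : extensional V.
Variable M : V -> Prop.
Hypothesis Mtrans : transitive_class M.
Hypothesis MZFC : ZFC (substructure M).
Implicit Types a b p x y z F : substructure M.

Lemma val_inj x y : val x = val y -> x = y.
Proof.
  intros E. apply (zfc_extensionality MZFC). intros z.
  change (val z ∈ val x <-> val z ∈ val y). now rewrite E.
Qed.

Lemma mem_val x (v : V) : v ∈ val x -> exists z, v = val z /\ z ∈ x.
Proof.
  intros H. exists (exist _ v (Mtrans (proj2_sig x) H)). split; [reflexivity|exact H].
Qed.

Lemma is_upair_val p a b : is_upair (val p) (val a) (val b) <-> is_upair p a b.
Proof.
  split.
  - intros H z. change (val z ∈ val p <-> z = a \/ z = b). rewrite (H (val z)).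
    split; (intros [E|E]; [left|right]; [..]); try (now apply val_inj); now subst.
  - intros H v. split.
    + intros Hv. destruct (mem_val Hv) as [z [-> Hz]]. apply H in Hz.
      destruct Hz as [->| ->]; auto.
    + intros [->| ->]; [change (a ∈ p)|change (b ∈ p)]; apply H; auto.
Qed.

(** Pairing in M yields a pair of a and b, and extensionality of V identifies it with v. *)
Lemma is_upair_val_exists a b (v : V) : is_upair v (val a) (val b) ->
  exists z, v = val z /\ is_upair z a b.
Proof.
  intros H. destruct (zfc_pairing MZFC a b) as [z Hz]. exists z.
  split; [|exact Hz]. apply Vext. intros w.
  rewrite (H w). apply is_upair_val in Hz. now rewrite (Hz w).
Qed.

Lemma is_opair_val p a b : is_opair (val p) (val a) (val b) <-> is_opair p a b.
Proof.
  split.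
  - intros H z. rewrite <- !is_upair_val. exact (H (val z)).
  - intros H v. split.
    + intros Hv. destruct (mem_val Hv) as [z [-> Hz]]. rewrite !is_upair_val.
      now apply H.
    + intros [Hv|Hv]; destruct (is_upair_val_exists Hv) as [z [-> Hz]];
        change (z ∈ p); apply H; auto.
Qed.

(* In [V] a pair {x, v} need not exist, and then {{x}} passes for (x, v): this
   is the only way in which [v] can fail to belong to [M]. *)
Lemma is_opair_val_inv p x y a (v : V) :
  is_opair p x y -> is_opair (val p) (val a) v ->
  (exists b, v = val b) \/ is_opair p a a.
Proof.
  intros H K.
  destruct (classic (exists b, v = val b)) as [B|N]; [now left|right].
  assert (E : forall z, z ∈ p -> is_upair z a a).
  { intros z Hz. destruct (proj1 (K (val z)) Hz) as [L|L].
    - now apply is_upair_val.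
    - assert (Hv : v ∈ val z) by (apply L; auto).
      destruct (mem_val Hv) as [b [-> _]]. destruct N. eauto. }
  intros z. split; [intros Hz; left; auto|].
  intros Hz. apply (K (val z)). left. apply is_upair_val. tauto.
Qed.

(** The right-hand side evaluates F in V, as the final theorem does. The degenerate case of
    [is_opair_val_inv] would mean F(a) = a. *)
Lemma value_val (Mwf : well_founded (@mem (substructure M))) (kappa mu F a b : substructure M) :
  infinite_cardinal kappa -> distinct_normal_measures kappa mu ->
  choice_function kappa mu F ->
  value F a b <-> exists A : V, app (val F) (val a) A /\ val b ∈ A.
Proof.
  intros Hkappa Hmu HF. split.
  - intros [A [[p [Hp E]] Hb]]. exists (val A). split; [|exact Hb].
    exists (val p). split; [exact Hp|]. now apply is_opair_val.
  - intros [v [[q [Hq K]] Hb]]. destruct (mem_val Hq) as [p [-> Hp]].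
    destruct (proj1 (proj1 HF) p Hp) as [x [y [_ E]]].
    destruct (is_opair_val_inv E K) as [[A ->]|B].
    + exists A. split; [|exact Hb]. exists p. split; [exact Hp|].
      now apply is_opair_val.
    + destruct (choice_function_app_irrefl MZFC Mwf Hkappa Hmu (F := F) (a := a) HF).
      exists p. auto.
Qed.

End Absoluteness.

Theorem theorem3p11
  (V : set_structure) (Vext : extensional V) (Vwf : well_founded (@mem V))
  (M : V -> Prop) (Mtrans : transitive_class M) (MZFC : ZFC (substructure M))
  (kappa mu : substructure M)
  (Hkappa : infinite_cardinal kappa)
  (Hmu : distinct_normal_measures kappa mu)
  (S : nat -> V)
  (HS : forall i, S i ∈ val kappa)
  (Sinc : strictly_increasing S) :
  generic_sequence kappa mu S <->
  (forall F : substructure M, choice_function kappa mu F ->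
     exists n, 0 < n /\
       forall i, n <= i ->
         exists A : V, app (val F) (S (i - 1)) A /\ S i ∈ A).
Proof.
  assert (Mwf : well_founded (@mem (substructure M))).
  { exact (wf_inverse_image _ _ _ (@proj1_sig V M) Vwf). }
  (* By transitivity each value of S is in M, even if S is not. *)
  pose (g := fun i => exist M (S i) (Mtrans (S i) (val kappa) (proj2_sig kappa) (HS i))
             : substructure M).
  assert (Hg : forall i, g i ∈ kappa) by exact HS.
  assert (Ginc : forall i j, i < j -> g i ∈ g j) by exact Sinc.
  pose proof (generic_sequence_characterization MZFC Mwf Hkappa Hmu Hg Ginc) as C.
  assert (E : forall (s : substructure M) n,
    (forall x : V, x ∈ val s <-> exists i, i < n /\ x = S i) <->
    (forall x, x ∈ s <-> exists i, i < n /\ x = g i)).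
  { intros s n. split; intros H x.
    - change (val x ∈ val s <-> exists i, i < n /\ x = g i). rewrite (H (val x)).
      split; intros [i [Hi K]]; exists i; (split; [exact Hi|]).
      + apply (val_inj MZFC). exact K.
      + now rewrite K.
    - split.
      + intros Hx. destruct (mem_val Mtrans Hx) as [z [-> Hz]]. apply H in Hz.
        destruct Hz as [i [Hi ->]]. now exists i.
      + intros [i [Hi ->]]. change (g i ∈ s). apply H. now exists i. }
  transitivity (forall F, choice_function kappa mu F ->
     exists n, 0 < n /\ forall i, n <= i -> value F (g (i - 1)) (g i)).
  - rewrite <- C. split.
    + intros [G [GG [_ GS]]]. exists G. split; [exact GG|]. intros n Hn.
      destruct (GS n Hn) as [p [s [F [Gp [Hp Hs]]]]]. exists p, s, F.
      split; [exact Gp|]. split; [exact Hp|]. now apply E.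
    + intros [G [GG GS]]. exists G. split; [exact GG|]. split; [exact Sinc|].
      intros n Hn. destruct (GS n Hn) as [p [s [F [Gp [Hp Hs]]]]]. exists p, s, F.
      split; [exact Gp|]. split; [exact Hp|]. now apply E.
  - split; intros H F HF; destruct (H F HF) as [n [Hn K]]; exists n;
      (split; [exact Hn|]); intros i Hi;
      apply (value_val Vext Mtrans MZFC Mwf (g (i - 1)) (g i) Hkappa Hmu HF);
      exact (K i Hi).
Qed.
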